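(* Let $f(u,v,s)=\big(u,\ u^2f_{21}(u)+v^2+usf_{24}(u,s),\ u^2f_{31}(u)+v^2f_{32}(u,v,s)+usf_{34}(u,s)\big)$ with $f_{32}=c_0(u,s)+vc_1(u,s)+v^2c_2(u,v^2,s)+v^3c_3(u,v^2,s)$, $c_0(0,0)=0$, and $$c_1(u,s)=s+usd_1(s)+u^2d_2(s)+u^3d_3(s)+u^4d_4(u,s)$$ with smooth $d_1,d_2,d_3,d_4$ and $d_2(0)>0$; put $d_{20}=\sqrt{d_2(0)}>0$. For $s=-\tilde s^2$, the points of $S_2(f)$ (singular points of $f(\cdot,\cdot,s)$ that are not cuspidal edges, i.e. $\{v=0,\ c_1(u,s)=0\}$) satisfy $v=0$ and $u=u(\pm\tilde s)$, where $u(\tilde s)$ is a smooth function with expansion $$u(\tilde s)=\frac{1}{d_{20}}\tilde s+\frac{1}{2d_{20}^4}\big(d_1(0)d_{20}^2-d_3(0)\big)\tilde s^2+\frac{1}{8d_{20}^7}\Big(\big(d_1(0)^2+4d_2'(0)\big)d_{20}^4-2\big(3d_1(0)d_3(0)+2d_4(0,0)\big)d_{20}^2+5d_3(0)^2\Big)\tilde s^3+O(\tilde s^4).$$ Moreover, for $\tilde s\neq0$ small, the germs of $f(\cdot,\cdot,-\tilde s^2)$ at $(u(\tilde s),0)$ and at $(u(-\tilde s),0)$ are both cuspidal cross caps.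
   Context: Here $f_{21},f_{31}$ are smooth in $u$, $f_{24},f_{34},c_0,c_1$ smooth in $(u,s)$, $c_2,c_3$ smooth in $(u,w,s)$. A cuspidal cross cap is a map-germ $\mathcal{A}$-equivalent to $(u,v)\mapsto(u,v^2,v^3u)$ at the origin (equivalently $(u,v^2,v^3(u\pm v^2))$), where $\mathcal{A}$-equivalence means equality after composing with diffeomorphism-germs of source and target. For each fixed $s$, $f(\cdot,\cdot,s)$ is a frontal with singular set $\{v=0\}$. *)

(* Defs.v *)
From mathcomp Require Import all_boot all_order all_algebra.
From mathcomp Require Import all_classical all_reals all_analysis.
Import numFieldNormedType.Exports.
Import Order.TTheory GRing.Theory Num.Theory.

Set Implicit Arguments.
Unset Strict Implicit.
Unset Printing Implicit Defensive.

Local Open Scope ring_scope.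
Local Open Scope classical_set_scope.

Section Defs.
Context {R : realType}.

(* C^k on a set U (meant to be open): all iterated directional derivatives
   up to order k exist on U and the k-th ones are continuous on U. *)
Fixpoint Ck {V W : normedModType R} (k : nat) (U : set V) (f : V -> W) : Prop :=
  match k with
  | O => forall x, U x -> {for x, continuous f}
  | k'.+1 => (forall x v, U x -> derivable f x v) /\
             (forall v : V, Ck k' U ('D_v f))
  end.

Definition smooth_on {V W : normedModType R} (U : set V) (f : V -> W) : Prop :=
  open U /\ forall k, Ck k U f.

Definition smooth_near {V W : normedModType R} (f : V -> W) (a : V) : Prop :=
  exists U : set V, U a /\ smooth_on U f.

Definition diffeo_germ {V : normedModType R} (phi : V -> V) (p : V) : Prop :=
  exists (U U' : set V) (chi : V -> V),
    [/\ U p, smooth_on U phi, smooth_on U' chi,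
        (forall x, U x -> U' (phi x) /\ chi (phi x) = x) &
        (forall y, U' y -> U (chi y) /\ phi (chi y) = y)].

Definition A_equiv_germ {V W : normedModType R} (g : V -> W) (p : V)
    (h : V -> W) (q : V) : Prop :=
  exists (phi : V -> V) (psi : W -> W),
    [/\ diffeo_germ phi p, phi p = q, diffeo_germ psi (g p), psi (g p) = h q &
        \forall x \near p, psi (g x) = h (phi x)].

Definition ccr_std (p : R * R) : R * R * R :=
  (p.1, p.2 ^+ 2, p.2 ^+ 3 * p.1).

Definition cuspidal_cross_cap (g : R * R -> R * R * R) (p : R * R) : Prop :=
  A_equiv_germ g p ccr_std (0, 0).

Definition c1_of (d1 d2 d3 : R -> R) (d4 : R * R -> R) (p : R * R) : R :=
  let u := p.1 in let s := p.2 in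
  s + u * s * d1 s + u ^+ 2 * d2 s + u ^+ 3 * d3 s + u ^+ 4 * d4 (u, s).

Definition f32_of (c0 c1 : R * R -> R) (c2 c3 : R * R * R -> R)
    (u v s : R) : R :=
  c0 (u, s) + v * c1 (u, s) + v ^+ 2 * c2 (u, v ^+ 2, s)
  + v ^+ 3 * c3 (u, v ^+ 2, s).

Definition f_map (f21 f31 : R -> R) (f24 f34 : R * R -> R) (f32 : R -> R -> R -> R)
    (s : R) (p : R * R) : R * R * R :=
  let u := p.1 in let v := p.2 in
  (u,
   u ^+ 2 * f21 u + v ^+ 2 + u * s * f24 (u, s),
   u ^+ 2 * f31 u + v ^+ 2 * f32 u v s + u * s * f34 (u, s)).

(* S_2(f) for fixed s: singular points that are not cuspidal edges,
   {v = 0, c1(u,s) = 0} *)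
Definition S2 (c1 : R * R -> R) (s : R) : set (R * R) :=
  [set p | p.2 = 0 /\ c1 (p.1, s) = 0].

End Defs.

(* Main.v *)
Require Import Defs.
From mathcomp Require Import all_boot all_order all_algebra.
From mathcomp Require Import all_classical all_reals all_analysis.
From mathcomp Require Import ring lra.
Import numFieldNormedType.Exports.
Import Order.TTheory GRing.Theory Num.Theory.
Set Implicit Arguments.
Unset Strict Implicit.
Unset Printing Implicit Defensive.
Local Open Scope ring_scope.
Local Open Scope classical_set_scope.

(** With s = -t^2, the equation c_1(u, s) = 0 reads u^2 D(u, t) = t^2 E(u, t)
    where D(0, 0) = d_2(0) > 0 and E(0, 0) = 1.  Hence c_1(u, -t^2) factors near
    the origin as G(u, t) G(u, -t) with G = u sqrt(D) - t sqrt(E) and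
    dG/du(0, 0) = sqrt(d_2(0)) <> 0.  The inverse k of G along the fibres t = const
    is smooth, and u(t) = k(0, t) is the required branch.

    If p is the cubic polynomial of the expansion, then c_1(p(t), -t^2) = O(t^5)
    while G(p(t), -t) ~ 2t, so G(p(t), t) = O(t^4); applying k gives
    p(t) - u(t) = O(t^4).

    At (u(t), 0) with t <> 0, dc_1/du = dG/du(u, t) G(u, -t) and
    G(u, -t) = 2 t sqrt(E) do not vanish.  Subtracting from the last two target
    coordinates functions of the first two turns f into (u, v^2, v^3 h(u, v^2)) with
    h(u, w) = c_1(u) + w c_3(u, w), and h is then taken as a new coordinate in both
    source and target.  Fibrewise inversion of h shows that these changes are
    diffeomorphism germs. *)

(** * Directional derivatives and difference quotients in normed spaces *)

Section DirectionalDerivative.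
Context {R : realType}.
Implicit Types V W Z : normedModType R.

Lemma is_derive_cvg V W (f : V -> W) (x v : V) (l : W) :
  (fun h : R => h^-1 *: (f (h *: v + x) - f x)) @ 0^' --> l -> is_derive x v f l.
Proof.
move=> fl; apply: DeriveDef; first by apply/cvg_ex; exists l.
exact/cvg_lim.
Qed.

Lemma cvg_is_derive V W (f : V -> W) (x v : V) (l : W) : is_derive x v f l ->
  (fun h : R => h^-1 *: (f (h *: v + x) - f x)) @ 0^' --> l.
Proof. by move=> [df <-]; exact: df. Qed.

Lemma is_derive_line V (g : V -> R) (z e : V) (c : R) :
  derivable g (z + c *: e) e ->
  is_derive c 1 (fun t : R => g (z + t *: e)) ('D_e g (z + c *: e)).
Proof.
move=> dg; apply: is_derive_cvg.
have /cvg_is_derive := derivableP dg; apply: cvg_trans.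
apply: near_eq_cvg; near=> h => /=.
by rewrite [_ *: 1]mulr1 scalerDl addrCA addrA.
Unshelve. all: by end_near. Qed.

(** The one-variable mean value theorem along the line [t |-> z + t *: e], between 0 and [s]. As [s]
    may have either sign, the intermediate point is located only by [|x| <= |s|], and the two
    orientations of the segment are handled separately. *)
Lemma directional_MVT V (g : V -> R) (z e : V) (s : R) :
  (forall x : R, `|x| <= `|s| -> derivable g (z + x *: e) e) ->
  exists2 x : R, `|x| <= `|s| & g (z + s *: e) - g z = s * 'D_e g (z + x *: e).
Proof.
move=> dg; pose f (t : R) := g (z + t *: e).
have df (x : R) : `|x| <= `|s| -> is_derive x 1 f ('D_e g (z + x *: e)).
  by move=> xs; apply: is_derive_line; exact: dg.
have cf (a b : R) : (forall x, x \in `[a, b]%R -> `|x| <= `|s|) ->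
    {within `[a, b], continuous f}.
  move=> ab; apply: derivable_within_continuous => x /ab xs.
  by have [] := df _ xs.
have f0 : f 0 = g z by rewrite /f scale0r addr0.
have [s0|s0] := leP 0 s.
- have H (x : R) : x \in `[0, s]%R -> `|x| <= `|s|.
    by rewrite in_itv /= => /andP[x0 xs]; rewrite !ger0_norm.
  have d x : x \in `]0, s[%R -> is_derive x 1 f ('D_e g (z + x *: e)).
    by move=> xs; apply/df/H; apply: subset_itv_oo_cc.
  have [x /H xs] := MVT_segment s0 d (cf _ _ H).
  by rewrite f0 subr0 mulrC => E; exists x.
- have H (x : R) : x \in `[s, 0]%R -> `|x| <= `|s|.
    rewrite in_itv /= => /andP[x0 xs]; rewrite !ler0_norm ?lerN2//.
    exact: ltW.
  have d x : x \in `]s, 0[%R -> is_derive x 1 f ('D_e g (z + x *: e)).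
    by move=> xs; apply/df/H; apply: subset_itv_oo_cc.
  have [x /H xs] := MVT_segment (ltW s0) d (cf _ _ H).
  rewrite f0 sub0r => E; exists x => //.
  rewrite -[LHS]opprB E; ring.
Qed.

(** The value at [s = 0] is filled in by the derivative, so that the product formula [slopeE] holds
    for every [s] and increments that happen to vanish need no separate treatment in limits. *)
Definition slope V (g : V -> R) (e z : V) (s : R) : R :=
  if s == 0 then 'D_e g z else (g (z + s *: e) - g z) / s.

Lemma slopeE V (g : V -> R) (e z : V) (s : R) :
  g (z + s *: e) - g z = s * slope g e z s.
Proof.
rewrite /slope; case: eqP => [->|/eqP s0]; last by rewrite mulrC divfK.
by rewrite scale0r addr0 subrr mul0r.
Qed.

(** By the mean value theorem each quotient is a value of ['D_e g] on a short segment issuing from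
    [z t], and continuity of ['D_e g] at [y] controls that value. The base point and the increment
    may thus vary together. *)
Lemma cvg_slope V (g : V -> R) (e y : V) (T : Type) (F : set_system T)
    {FF : Filter F} (z : T -> V) (s : T -> R) :
  (\forall x \near y, derivable g x e) -> {for y, continuous ('D_e g)} ->
  z @ F --> y -> s @ F --> (0 : R) ->
  (fun t => slope g e (z t) (s t)) @ F --> 'D_e g y.
Proof.
move=> dg cg zy s0; apply/cvgrPdist_lt => eps eps0.
have /cvgrPdist_lt/(_ _ eps0) cge := cg.
have /nbhs_normP[d /= d0 dP] : nbhs y
   [set x | derivable g x e /\ `|'D_e g y - 'D_e g x| < eps].
  by near=> x; split; near: x.
(* Half of the radius [d] is left to the base point and half to the displacement; dividing by
   [1 + |e|] rather than by [|e|] admits [e = 0]. *)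
have c0 : 0 < 1 + `|e| by rewrite ltr_pwDl.
have d20 : 0 < d / 2 by rewrite divr_gt0.
have dc0 : 0 < d / 2 / (1 + `|e|) by rewrite divr_gt0.
near=> t.
have zt : `|y - z t| < d / 2.
  by near: t; move/cvgrPdist_lt : zy => /(_ _ d20).
have st : `|s t| < d / 2 / (1 + `|e|).
  have : `|0 - s t| < d / 2 / (1 + `|e|).
    by near: t; move/cvgrPdist_lt : s0 => /(_ _ dc0).
  by rewrite sub0r normrN.
have H (x : R) : `|x| <= `|s t| -> ball_ Num.norm y d (z t + x *: e).
  move=> xs /=; rewrite opprD addrA (le_lt_trans (ler_normB _ _))//.
  rewrite (splitr d) ltrD// normrZ.
  rewrite (@le_lt_trans _ _ (`|s t| * (1 + `|e|)))//.
    by apply: ler_pM => //; rewrite lerDr.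
  by rewrite -ltr_pdivlMr.
have [|x /H /dP[_ xeps] E] := @directional_MVT _ g (z t) e (s t).
  by move=> x /H /dP[].
rewrite /slope; case: eqP => st0.
  have /dP[_] : ball_ Num.norm y d (z t).
    by have := H 0; rewrite scale0r addr0; apply; rewrite normr0.
  by [].
by rewrite E mulrC mulKf//; exact/eqP.
Unshelve. all: by end_near. Qed.

End DirectionalDerivative.

(** * Maps of class C^n on an open set and their closure properties *)

Section Cn.
Context {R : realType}.
Implicit Types V W Z : normedModType R.

(* [Ck] at level [k] does not by itself give continuity of the lower derivatives,
   which the product and chain rules need at a fixed order. *)
Fixpoint Cn V W (k : nat) (U : set V) (f : V -> W) : Prop :=
  (forall x, U x -> {for x, continuous f}) /\
  if k is k'.+1 then (forall x v, U x -> derivable f x v) /\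
                     (forall v : V, Cn k' U ('D_v f))
  else True.

Lemma Cn_continuous V W k (U : set V) (f : V -> W) :
  Cn k U f -> forall x, U x -> {for x, continuous f}.
Proof. by case: k => [|k] []. Qed.

Lemma Cn_Ck V W k (U : set V) (f : V -> W) : Cn k U f -> Ck k U f.
Proof.
elim: k f => [|k IH] f; first by case.
by case=> _ [df Df]; split=> // v; exact/IH/Df.
Qed.

(** Continuity of an iterated derivative is read from the instance of [Ck] whose order is exactly
    that of the derivative. *)
Lemma Ck_Cn V W (U : set V) (f : V -> W) :
  (forall k, Ck k U f) -> forall k, Cn k U f.
Proof.
move=> Cf k; elim: k f Cf => [|k IH] f Cf; first by split=> //; exact: (Cf 0).
split; first exact: (Cf 0).
split; first by case: (Cf 1).
by move=> v; apply: IH => j; case: (Cf j.+1) => _; exact.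
Qed.

Lemma Cn_S V W k (U : set V) (f : V -> W) : Cn k.+1 U f -> Cn k U f.
Proof.
elim: k f => [|k IH] f; first by move=> [].
by move=> [cf [df Df]]; split => //; split=> // v; exact/IH/Df.
Qed.

Lemma Cn_subset V W k (U U' : set V) (f : V -> W) :
  U `<=` U' -> Cn k U' f -> Cn k U f.
Proof.
move=> UU'; elim: k f => [|k IH] f.
  by move=> [cf _]; split=> // x /UU'; exact: cf.
move=> [cf [df Df]]; split; first by move=> x /UU'; exact: cf.
by split=> [x v /UU' /df|v]; [exact|exact/IH/Df].
Qed.

Lemma near_eq_continuous V W (f g : V -> W) (x : V) :
  (\forall y \near x, f y = g y) ->
  {for x, continuous f} -> {for x, continuous g}.
Proof.
move=> fg cf; have fgx := nbhs_singleton fg; move: cf.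
rewrite /prop_for /continuous_at fgx => h; apply: cvg_trans h.
by apply: near_eq_cvg; apply: filterS fg => y ->.
Qed.

Lemma eq_Cn V W k (U : set V) (f g : V -> W) : open U ->
  (forall x, U x -> f x = g x) -> Cn k U f -> Cn k U g.
Proof.
move=> oU; elim: k f g => [|k IH] f g fg.
  move=> [cf _]; split=> // x Ux; apply: near_eq_continuous (cf x Ux).
  by near=> y; apply: fg; near: y; exact: open_nbhs_nbhs.
move=> [cf [df Df]].
have nfg x : U x -> \forall y \near x, f y = g y.
  by move=> Ux; near=> y; apply: fg; near: y; exact: open_nbhs_nbhs.
split; first by move=> x Ux; apply: near_eq_continuous (cf x Ux); exact: nfg.
split=> [x v Ux|v].
  by apply: near_eq_derivable (df _ _ Ux); exact: nfg.
by apply: IH (Df v) => x Ux; apply: near_eq_derive; exact: nfg.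
Unshelve. all: by end_near. Qed.

(** The inductive step of the closure properties below: the derivative is supplied as an explicit
    formula, which has to agree with ['D_v f] on the open set [U] only. *)
Lemma Cn_succ V W k (U : set V) (f : V -> W) (df : V -> V -> W) : open U ->
  (forall x, U x -> {for x, continuous f}) ->
  (forall x v, U x -> is_derive x v f (df v x)) ->
  (forall v, Cn k U (df v)) -> Cn k.+1 U f.
Proof.
move=> oU cf fdf Cdf; split=> //; split=> [x v /(fdf _ v)[]//|v].
by apply: eq_Cn (Cdf v) => // x /(fdf _ v)[].
Qed.

Lemma Cn_is_derive V W k (U : set V) (f : V -> W) x v :
  Cn k.+1 U f -> U x -> is_derive x v f ('D_v f x).
Proof. by move=> [_ [df _]] Ux; exact/derivableP/df. Qed.

Lemma Cn_derive V W k (U : set V) (f : V -> W) v :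
  Cn k.+1 U f -> Cn k U ('D_v f).
Proof. by move=> [_ [_ +]]; exact. Qed.

Lemma Cn_cst V W k (U : set V) (c : W) : open U -> Cn k U (fun=> c).
Proof.
move=> oU; elim: k c => [|k IH] c; first by split=> // x _; exact: cvg_cst.
apply: (Cn_succ (df := fun _ _ => 0)) => // x _; exact: cvg_cst.
Qed.

Lemma Cn_linear V W k (U : set V) (f : {linear V -> W}) : open U ->
  continuous f -> Cn k U f.
Proof.
move=> oU cf; case: k => [|k]; first by split=> // x _; exact: cf.
apply: (Cn_succ (df := fun v _ => f v)) => // [x _|x v _|v]; first exact: cf.
  apply: is_derive_cvg; apply: cvg_near_cst.
  near=> h; rewrite [f (_ + _)]linearD linearZ_LR /= addrK scalerA mulVf ?scale1r//.
  by near: h; exact: nbhs_dnbhs_neq.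
exact: Cn_cst.
Unshelve. all: by end_near. Qed.

(** For a linear inner map the increment is exactly [h *: f v], so the derivative of the composite
    along [v] is ['D_(f v) g] composed with [f], and the induction repeats. *)
Lemma Cn_comp_linear V W Z k (U : set W) (g : W -> Z) (f : {linear V -> W}) :
  open U -> continuous f -> Cn k U g -> Cn k (f @^-1` U) (g \o f).
Proof.
move=> oU cf; have oU' : open (f @^-1` U) by move/continuousP : cf; apply.
elim: k g => [|k IH] g.
  move=> [cg _]; split=> // x Ux; apply: continuous_comp; [exact: cf|exact: cg].
move=> [cg [dg Dg]].
apply: (Cn_succ (df := fun v => 'D_(f v) g \o f)) => // [x Ux|x v Ux|v].
- by apply: continuous_comp; [exact: cf|exact: cg].
- apply: is_derive_cvg.
  have /cvg_is_derive := derivableP (dg _ (f v) Ux).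
  apply: cvg_trans; apply: near_eq_cvg; near=> h.
  by rewrite /= [f (_ + _)]linearD linearZ_LR.
- exact/IH/Dg.
Unshelve. all: by end_near. Qed.

Lemma CnD V W k (U : set V) (f g : V -> W) : open U ->
  Cn k U f -> Cn k U g -> Cn k U (fun x => f x + g x).
Proof.
move=> oU; elim: k f g => [|k IH] f g Cf Cg.
  by split=> // x Ux; apply: cvgD; [case: Cf => /(_ _ Ux)|case: Cg => /(_ _ Ux)].
apply: (Cn_succ (df := fun v x => 'D_v f x + 'D_v g x)) => // [x Ux|x v Ux|v].
- by apply: cvgD; [exact: Cn_continuous Cf _ Ux|exact: Cn_continuous Cg _ Ux].
- have df := Cn_is_derive v Cf Ux; have dg := Cn_is_derive v Cg Ux.
  exact: is_deriveD.
- by apply: IH; exact: Cn_derive.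
Qed.

Lemma CnM V k (U : set V) (f g : V -> R) : open U ->
  Cn k U f -> Cn k U g -> Cn k U (fun x => f x * g x).
Proof.
move=> oU; elim: k f g => [|k IH] f g Cf Cg.
  by split=> // x Ux; apply: cvgM; [case: Cf => /(_ _ Ux)|case: Cg => /(_ _ Ux)].
apply: (Cn_succ (df := fun v x => f x * 'D_v g x + g x * 'D_v f x)) =>
    // [x Ux|x v Ux|v].
- by apply: cvgM; [exact: Cn_continuous Cf _ Ux|exact: Cn_continuous Cg _ Ux].
- have df := Cn_is_derive v Cf Ux; have dg := Cn_is_derive v Cg Ux.
  exact: is_deriveM.
- by apply: CnD => //; apply: IH; solve [exact: Cn_derive|exact: Cn_S].
Qed.

Lemma CnV V k (U : set V) (f : V -> R) : open U -> (forall x, U x -> f x != 0) ->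
  Cn k U f -> Cn k U (fun x => (f x)^-1).
Proof.
move=> oU f0; elim: k => [|k IH] Cf.
  by split=> // x Ux; apply: cvgV; [exact: f0|case: Cf => /(_ _ Ux)].
apply: (Cn_succ (df := fun v x => (-1) * ((f x)^-1 * (f x)^-1 * 'D_v f x))) =>
    // [x Ux|x v Ux|v].
- by apply: cvgV; [exact: f0|exact: Cn_continuous Cf _ Ux].
- have [df _] := Cn_is_derive v Cf Ux.
  split; first exact: derivableV (f0 _ Ux) df.
  by rewrite (deriveV (f0 _ Ux) df) -exprVn expr2 mulN1r scaleNr.
- apply: CnM => //; first exact: Cn_cst.
  apply: CnM => //; last exact: Cn_derive.
  by apply: CnM => //; apply: IH; exact: Cn_S.
Qed.

Lemma Cn_sqrt V k (U : set V) (f : V -> R) : open U -> (forall x, U x -> 0 < f x) ->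
  Cn k U f -> Cn k U (fun x => Num.sqrt (f x)).
Proof.
move=> oU f0; elim: k => [|k IH] Cf.
  split=> // x Ux; apply: (@continuous_comp _ _ _ f Num.sqrt).
    exact: Cn_continuous Cf _ Ux.
  exact: sqrt_continuous.
apply: (Cn_succ (df := fun v x => (2 * Num.sqrt (f x))^-1 * 'D_v f x)) =>
    // [x Ux|x v Ux|v].
- apply: (@continuous_comp _ _ _ f Num.sqrt).
    exact: Cn_continuous Cf _ Ux.
  exact: sqrt_continuous.
- have df := Cn_is_derive v Cf Ux.
  (* Restricting [f] to the line [h |-> h *: v + x] reduces the claim to the one-variable chain
     rule. *)
  have dl : is_derive (0 : R) 1 (fun h : R => f (h *: v + x)) ('D_v f x).
    apply: is_derive_cvg; have := cvg_is_derive df.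
    apply: cvg_trans; apply: near_eq_cvg; near=> t => /=.
    by rewrite addr0 scale0r add0r [_ *: 1]mulr1.
  have sl : is_derive (f (0 *: v + x)) 1 Num.sqrt (2 * Num.sqrt (f x))^-1.
    by rewrite scale0r add0r; apply: is_derive1_sqrt; exact: f0.
  have := is_derive1_comp sl dl.
  move=> /cvg_is_derive h; apply: is_derive_cvg.
  apply: cvg_trans h; apply: near_eq_cvg; near=> t => /=.
  by rewrite addr0 scale0r add0r [_ *: 1]mulr1.
- apply: CnM => //; last exact: Cn_derive.
  apply: CnV => //.
    by move=> x Ux; rewrite mulf_neq0// gt_eqF// sqrtr_gt0 f0.
  by apply: CnM; [exact: oU|exact: Cn_cst|apply: IH; exact: Cn_S].
Unshelve. all: by end_near. Qed.

Lemma Cn_pair V W Z k (U : set V) (f : V -> W) (g : V -> Z) : open U ->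
  Cn k U f -> Cn k U g -> Cn k U (fun x => (f x, g x)).
Proof.
move=> oU; elim: k f g => [|k IH] f g Cf Cg.
  by split=> // x Ux; apply: cvg_pair; [case: Cf => /(_ _ Ux)|case: Cg => /(_ _ Ux)].
apply: (Cn_succ (df := fun v x => ('D_v f x, 'D_v g x))) => // [x Ux|x v Ux|v].
- by apply: cvg_pair; [exact: Cn_continuous Cf _ Ux|exact: Cn_continuous Cg _ Ux].
- have df := Cn_is_derive v Cf Ux; have dg := Cn_is_derive v Cg Ux.
  apply: is_derive_cvg.
  by apply: cvg_pair; exact: cvg_is_derive.
- by apply: IH; exact: Cn_derive.
Qed.

End Cn.

(** * The chain rule for functions of two or three real variables *)

Section Composition.
Context {R : realType}.
Implicit Types V W Z : normedModType R.

Lemma cvg_along_line V (x v : V) : (fun h : R => h *: v + x) @ 0^' --> x.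
Proof.
have : (fun h : R => h *: v + x) @ (0 : R) --> (0 : R) *: v + x.
  by apply: cvgD; [apply: cvgZr_tmp; exact: cvg_id|exact: cvg_cst].
rewrite scale0r add0r; apply: cvg_trans; apply: cvg_app; exact: cvg_within.
Qed.

Lemma cvg_to_pair (U T : topologicalType) (X : Type) (F : set_system X)
    (f : X -> U) (g : X -> T) (a : U) (b : T) : Filter F ->
  f @ F --> a -> g @ F --> b -> (fun x => (f x, g x)) @ F --> (a, b).
Proof. by move=> FF fa gb; exact: cvg_pair fa gb. Qed.

(** The coordinates are moved one at a time, from [y] through [z1] and [z2] to the new point. Each
    increment of [g] is the increment of one coordinate times a [slope] whose base point tends to
    [y], so [cvg_slope] yields the three partial derivatives. *)
Lemma is_derive_comp3 V (g : R * R * R -> R) (f1 f2 f3 : V -> R) (x v : V)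
    (e1 := (1, 0, 0) : R * R * R) (e2 := (0, 1, 0) : R * R * R)
    (e3 := (0, 0, 1) : R * R * R) (y := (f1 x, f2 x, f3 x)) :
  (\forall z \near y, forall e, derivable g z e) ->
  (forall e, {for y, continuous ('D_e g)}) ->
  {for x, continuous f1} -> {for x, continuous f2} -> {for x, continuous f3} ->
  derivable f1 x v -> derivable f2 x v -> derivable f3 x v ->
  is_derive x v (fun x => g (f1 x, f2 x, f3 x))
    ('D_v f1 x * 'D_e1 g y + 'D_v f2 x * 'D_e2 g y + 'D_v f3 x * 'D_e3 g y).
Proof.
move=> dg cg c1 c2 c3 d1 d2 d3; apply: is_derive_cvg.
have dge e : \forall z \near y, derivable g z e by apply: filterS dg.
pose s (f : V -> R) (h : R) := f (h *: v + x) - f x.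
have cs (f : V -> R) : {for x, continuous f} ->
    (fun h : R => f (h *: v + x)) @ 0^' --> f x.
  by move=> cf; apply: (cvg_comp _ _ (@cvg_along_line _ x v)) cf.
have s0 (f : V -> R) : {for x, continuous f} -> s f @ 0^' --> (0 : R).
  move=> /cs cf; suff : s f @ 0^' --> f x - f x by rewrite subrr.
  by apply: cvgB; [exact: cf|exact: cvg_cst].
have ds (f : V -> R) : derivable f x v -> (fun h => h^-1 * s f h) @ 0^' --> 'D_v f x.
  by move=> /derivableP /cvg_is_derive.
pose z1 (h : R) := (f1 (h *: v + x), f2 x, f3 x).
pose z2 (h : R) := (f1 (h *: v + x), f2 (h *: v + x), f3 x).
have z1y : z1 @ 0^' --> y.
  apply: cvg_to_pair; last exact: cvg_cst.
  by apply: cvg_to_pair; [exact: cs|exact: cvg_cst].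
have z2y : z2 @ 0^' --> y.
  apply: cvg_to_pair; last exact: cvg_cst.
  by apply: cvg_to_pair; exact: cs.
have l1 := cvg_slope (e := e1) (dge e1) (cg e1) (@cvg_cst _ y _ (0 : R)^' _) (s0 _ c1).
have l2 := cvg_slope (e := e2) (dge e2) (cg e2) z1y (s0 _ c2).
have l3 := cvg_slope (e := e3) (dge e3) (cg e3) z2y (s0 _ c3).
have L : (fun h => h^-1 * s f1 h * slope g e1 y (s f1 h)
    + h^-1 * s f2 h * slope g e2 (z1 h) (s f2 h)
    + h^-1 * s f3 h * slope g e3 (z2 h) (s f3 h)) @ 0^' -->
   'D_v f1 x * 'D_e1 g y + 'D_v f2 x * 'D_e2 g y + 'D_v f3 x * 'D_e3 g y.
  apply: cvgD; first apply: cvgD; (apply: cvgM; first exact: ds);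
    [exact: l1|exact: l2|exact: l3].
apply: cvg_trans L; apply: near_eq_cvg; near=> h.
have P (a b c a' b' c' t : R) :
    (a, b, c) + t *: (a', b', c') = (a + t * a', b + t * b', c + t * c') by [].
have E1 : s f1 h * slope g e1 y (s f1 h) = g (z1 h) - g y.
  rewrite -slopeE; congr (g _ - _).
  by rewrite /y /e1 P mulr1 !mulr0 !addr0 addrC subrK.
have E2 : s f2 h * slope g e2 (z1 h) (s f2 h) = g (z2 h) - g (z1 h).
  rewrite -slopeE; congr (g _ - _).
  by rewrite /z1 /e2 P mulr1 !mulr0 !addr0 [f2 x + _]addrC subrK.
have E3 : s f3 h * slope g e3 (z2 h) (s f3 h) =
    g (f1 (h *: v + x), f2 (h *: v + x), f3 (h *: v + x)) - g (z2 h).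
  rewrite -slopeE; congr (g _ - _).
  by rewrite /z2 /e3 P mulr1 !mulr0 !addr0 [f3 x + _]addrC subrK.
rewrite -!mulrA E1 E2 E3 -!mulrDr; congr (_ * _); ring.
Unshelve. all: by end_near. Qed.
End Composition.

Section CnComposition.
Context {R : realType}.
Implicit Types V W Z : normedModType R.

(** Each directional derivative is a sum of derivatives of the inner maps times partial derivatives
    of [g] at the same inner maps; the induction on [k] therefore generalizes [g]. *)
Lemma Cn_comp3 V k (U : set V) (U' : set (R * R * R)) (g : R * R * R -> R)
    (f1 f2 f3 : V -> R) : open U -> open U' ->
  (forall x, U x -> U' (f1 x, f2 x, f3 x)) -> Cn k U' g ->
  Cn k U f1 -> Cn k U f2 -> Cn k U f3 ->
  Cn k U (fun x => g (f1 x, f2 x, f3 x)).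
Proof.
move=> oU oU' UU'.
have cont (h : R * R * R -> R) : Cn 0 U' h -> Cn 0 U f1 -> Cn 0 U f2 -> Cn 0 U f3 ->
    forall x, U x -> {for x, continuous (fun x => h (f1 x, f2 x, f3 x))}.
  move=> [ch _] [c1 _] [c2 _] [c3 _] x Ux.
  apply: (@continuous_comp _ _ _ (fun x => (f1 x, f2 x, f3 x)) h); last exact/ch/UU'.
  apply: cvg_to_pair; last exact: c3.
  by apply: cvg_to_pair; [exact: c1|exact: c2].
have C0 j (W : normedModType R) (O : set W) (h : W -> R) : Cn j O h -> Cn 0 O h.
  by elim: j => // j IH /Cn_S.
elim: k g => [|k IH] g Cg C1 C2 C3; first by split=> //; exact: cont.
have D1 := Cn_S C1; have D2 := Cn_S C2; have D3 := Cn_S C3.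
apply: (Cn_succ (df := fun v x =>
  'D_v f1 x * 'D_(1, 0, 0) g (f1 x, f2 x, f3 x) +
  'D_v f2 x * 'D_(0, 1, 0) g (f1 x, f2 x, f3 x) +
  'D_v f3 x * 'D_(0, 0, 1) g (f1 x, f2 x, f3 x))) => // [x Ux|x v Ux|v].
- by apply: cont; solve [exact: Ux|apply: C0; eassumption].
- apply: is_derive_comp3.
  + have := UU' _ Ux => Uy; near=> z => e.
    have Uz : U' z by near: z; exact: open_nbhs_nbhs.
    by case: (Cn_is_derive e Cg Uz).
  + by move=> e; apply: Cn_continuous (Cn_derive e Cg) _ (UU' _ Ux).
  + exact: Cn_continuous C1 _ Ux.
  + exact: Cn_continuous C2 _ Ux.
  + exact: Cn_continuous C3 _ Ux.
  + by case: (Cn_is_derive v C1 Ux).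
  + by case: (Cn_is_derive v C2 Ux).
  + by case: (Cn_is_derive v C3 Ux).
- have CD (f : V -> R) e : Cn k.+1 U f ->
      Cn k U (fun x => 'D_v f x * 'D_e g (f1 x, f2 x, f3 x)).
    move=> Cf; apply: CnM => //; first exact: Cn_derive.
    by apply: (IH ('D_e g)) => //; exact: Cn_derive.
  by apply: CnD => //; first apply: CnD => //; exact: CD.
Unshelve. all: by end_near. Qed.

(** The function [g] is regarded as a function of three variables, constant in the last one, into
    which 0 is substituted. *)
Lemma Cn_comp2 V k (U : set V) (U' : set (R * R)) (g : R * R -> R)
    (f1 f2 : V -> R) : open U -> open U' ->
  (forall x, U x -> U' (f1 x, f2 x)) -> Cn k U' g ->
  Cn k U f1 -> Cn k U f2 -> Cn k U (fun x => g (f1 x, f2 x)).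
Proof.
move=> oU oU' UU' Cg C1 C2.
have cfst : continuous (fst : R * R * R -> R * R) by move=> x; exact: cvg_fst.
apply: (@Cn_comp3 _ _ _ (fst @^-1` U') (g \o fst) f1 f2 (fun=> 0)) => //.
- by move/continuousP : cfst; apply.
- exact: (@Cn_comp_linear _ _ _ _ _ _ g (fst : {linear (R * R * R)%type -> (R * R)%type})).
- exact: Cn_cst.
Qed.

End CnComposition.

(** * Germs of smooth maps at a point *)

Section SmoothGerms.
Context {R : realType}.
Implicit Types V W Z : normedModType R.

Lemma smooth_nearP V W (f : V -> W) (a : V) : smooth_near f a <->
  exists U : set V, [/\ U a, open U & forall k, Cn k U f].
Proof.
split=> [[U [Ua [oU Cf]]]|[U [Ua oU Cf]]]; exists U.
  by split=> //; exact: Ck_Cn.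
by split=> //; split=> // k; exact: Cn_Ck.
Qed.

Lemma smooth_near_near V W (f : V -> W) (a : V) :
  smooth_near f a -> \forall x \near a, smooth_near f x.
Proof.
move=> [U [Ua [oU Cf]]]; near=> x; exists U; split=> //.
by near: x; exact: open_nbhs_nbhs.
Unshelve. all: by end_near. Qed.

Lemma smooth_near_continuous V W (f : V -> W) (a : V) :
  smooth_near f a -> {for a, continuous f}.
Proof. by move=> /smooth_nearP[U [Ua oU /(_ 0)[+ _]]]; exact. Qed.

Lemma smooth_near_derivable V W (f : V -> W) (a v : V) :
  smooth_near f a -> derivable f a v.
Proof. by move=> [U [Ua [oU /(_ 1)[+ _]]]]; exact. Qed.

Lemma smooth_near_derive V W (f : V -> W) (a v : V) :
  smooth_near f a -> smooth_near ('D_v f) a.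
Proof.
move=> [U [Ua [oU Cf]]]; exists U; split=> //; split=> // k.
by case: (Cf k.+1) => _; exact.
Qed.

Lemma eq_smooth_near V W (f g : V -> W) (a : V) :
  (\forall x \near a, f x = g x) -> smooth_near f a -> smooth_near g a.
Proof.
move=> fg /smooth_nearP[U [Ua oU Cf]]; apply/smooth_nearP.
exists (U `&` (fun x => f x = g x)^°); split.
- by split.
- by apply: openI => //; exact: open_interior.
- move=> k; apply: (@eq_Cn _ _ _ _ _ f) => [|x [_ /interior_subset]|] //.
    by apply: openI => //; exact: open_interior.
  by apply: Cn_subset (Cf k) => x [].
Qed.

Lemma smooth_near_cst V W (c : W) (a : V) : smooth_near (fun=> c) a.
Proof.
apply/smooth_nearP; exists setT; split=> [//||k]; first exact: openT.
by apply: Cn_cst; exact: openT.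
Qed.

Lemma smooth_near_linear V W (f : {linear V -> W}) (a : V) :
  continuous f -> smooth_near f a.
Proof.
move=> cf; apply/smooth_nearP; exists setT; split=> [//||k]; first exact: openT.
by apply: Cn_linear => //; exact: openT.
Qed.

Lemma smooth_near_id V (a : V) : smooth_near (fun x => x) a.
Proof. by apply: (@smooth_near_linear _ _ idfun) => x; exact: cvg_id. Qed.

Lemma smooth_near_fst V W (a : V * W) : smooth_near (fun x => x.1) a.
Proof.
by apply: (@smooth_near_linear _ _ (fst : {linear (V * W)%type -> V})) => x;
  exact: cvg_fst.
Qed.

Lemma smooth_near_snd V W (a : V * W) : smooth_near (fun x => x.2) a.
Proof.
by apply: (@smooth_near_linear _ _ (snd : {linear (V * W)%type -> W})) => x;
  exact: cvg_snd.
Qed.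

(** Both germs are restricted to a common open set, so that a binary operation has to be checked
    only at each finite order. *)
Lemma smooth_near2 V (W1 W2 W : normedModType R) (f : V -> W1) (g : V -> W2)
    (h : V -> W) (a : V) :
  (forall k (U : set V), open U -> Cn k U f -> Cn k U g -> Cn k U h) ->
  smooth_near f a -> smooth_near g a -> smooth_near h a.
Proof.
move=> fgh /smooth_nearP[U [Ua oU Cf]] /smooth_nearP[U' [U'a oU' Cg]].
have oI := openI oU oU'.
apply/smooth_nearP; exists (U `&` U'); split=> // k; apply: fgh => //.
  by apply: Cn_subset (Cf k) => x [].
by apply: Cn_subset (Cg k) => x [].
Qed.

Lemma smooth_nearD V W (f g : V -> W) (a : V) : smooth_near f a ->
  smooth_near g a -> smooth_near (fun x => f x + g x) a.
Proof. by apply: smooth_near2 => k U oU; exact: CnD. Qed.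

Lemma smooth_nearM V (f g : V -> R) (a : V) : smooth_near f a ->
  smooth_near g a -> smooth_near (fun x => f x * g x) a.
Proof. by apply: smooth_near2 => k U oU; exact: CnM. Qed.

Lemma smooth_near_pair V W Z (f : V -> W) (g : V -> Z) (a : V) :
  smooth_near f a -> smooth_near g a -> smooth_near (fun x => (f x, g x)) a.
Proof. by apply: smooth_near2 => k U oU; exact: Cn_pair. Qed.

Lemma smooth_nearN V (f : V -> R) (a : V) :
  smooth_near f a -> smooth_near (fun x => - f x) a.
Proof.
move=> sf; apply: eq_smooth_near (smooth_nearM (smooth_near_cst (-1 : R) a) sf).
by near=> x; rewrite mulN1r.
Unshelve. all: by end_near. Qed.

Lemma smooth_nearB V (f g : V -> R) (a : V) : smooth_near f a ->
  smooth_near g a -> smooth_near (fun x => f x - g x) a.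
Proof. by move=> sf /smooth_nearN; exact: smooth_nearD. Qed.

Lemma smooth_nearX V (f : V -> R) n (a : V) :
  smooth_near f a -> smooth_near (fun x => f x ^+ n) a.
Proof.
move=> sf; elim: n => [|n IH]; first exact: smooth_near_cst.
by apply: eq_smooth_near (smooth_nearM sf IH); near=> x; rewrite exprS.
Unshelve. all: by end_near. Qed.

Lemma smooth_near_sqrt V (f : V -> R) (a : V) : 0 < f a ->
  smooth_near f a -> smooth_near (fun x => Num.sqrt (f x)) a.
Proof.
move=> fa sf; have cf := smooth_near_continuous sf.
move/smooth_nearP : sf => [U [Ua oU Cf]].
have oI : open (U `&` (fun x => 0 < f x)^°).
  by apply: openI => //; exact: open_interior.
apply/smooth_nearP; exists (U `&` (fun x => 0 < f x)^°); split=> // [|k].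
  by split=> //; exact: (cvgr_gt (f a)) cf _ fa.
apply: Cn_sqrt => //; first by move=> x [_ /interior_subset].
by apply: Cn_subset (Cf k) => x [].
Qed.

Lemma smooth_near_comp3 V (g : R * R * R -> R) (f1 f2 f3 : V -> R) (a : V) :
  smooth_near g (f1 a, f2 a, f3 a) -> smooth_near f1 a -> smooth_near f2 a ->
  smooth_near f3 a -> smooth_near (fun x => g (f1 x, f2 x, f3 x)) a.
Proof.
move=> /smooth_nearP[U' [Ua' oU' Cg]] s1 s2 s3.
have c : {for a, continuous (fun x => (f1 x, f2 x, f3 x))}.
  by apply: smooth_near_continuous; do 2?apply: smooth_near_pair.
move: s1 s2 s3 => /smooth_nearP[U1 [Ua1 o1 C1]] /smooth_nearP[U2 [Ua2 o2 C2]].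
move=> /smooth_nearP[U3 [Ua3 o3 C3]].
set U := U1 `&` (U2 `&` (U3 `&` (fun x => U' (f1 x, f2 x, f3 x))^°)).
have oU : open U by do 3?apply: openI => //; exact: open_interior.
apply/smooth_nearP; exists U; split=> [|//|k].
  do 3!split=> //; apply: (c U'); exact: open_nbhs_nbhs.
apply: Cn_comp3 (Cg k) _ _ _ => //.
- by move=> x [_ [_ [_ /interior_subset]]].
- by apply: Cn_subset (C1 k) => x [].
- by apply: Cn_subset (C2 k) => x [_ []].
- by apply: Cn_subset (C3 k) => x [_ [_ []]].
Qed.

Lemma smooth_near_comp2 V (g : R * R -> R) (f1 f2 : V -> R) (a : V) :
  smooth_near g (f1 a, f2 a) -> smooth_near f1 a -> smooth_near f2 a ->
  smooth_near (fun x => g (f1 x, f2 x)) a.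
Proof.
move=> /smooth_nearP[U' [Ua' oU' Cg]] s1 s2.
have cfst : continuous (fst : R * R * R -> R * R) by move=> x; exact: cvg_fst.
apply: (@smooth_near_comp3 _ (g \o fst) f1 f2 (fun=> 0)) => //.
  apply/smooth_nearP; exists (fst @^-1` U'); split => // [|k].
    by move/continuousP : cfst; apply.
  exact: (@Cn_comp_linear _ _ _ _ _ _ g (fst : {linear (R * R * R)%type -> (R * R)%type})).
exact: smooth_near_cst.
Qed.

Lemma smooth_near_comp1 V (g : R -> R) (f : V -> R) (a : V) :
  smooth_near g (f a) -> smooth_near f a -> smooth_near (fun x => g (f x)) a.
Proof.
move=> /smooth_nearP[U' [Ua' oU' Cg]] sf.
have cfst : continuous (fst : R * R -> R) by move=> x; exact: cvg_fst.
apply: (@smooth_near_comp2 _ (g \o fst) f (fun=> 0)) => //.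
  apply/smooth_nearP; exists (fst @^-1` U'); split => // [|k].
    by move/continuousP : cfst; apply.
  exact: (@Cn_comp_linear _ _ _ _ _ _ g (fst : {linear (R * R)%type -> R})).
exact: smooth_near_cst.
Qed.

End SmoothGerms.

(** * Inversion in the first variable, with the second as a parameter *)

Section FibredInverse.
Context {R : realType}.
Variables (h : R * R -> R) (u0 w0 r : R) (O : set (R * R)).
Hypothesis r0 : 0 < r.
Hypothesis oO : open O.
Hypothesis Ch : forall k, Cn k O h.
(** Two points of a fibre within [r] of [u0] differ by at most [2 * r]. The points supplied by
    [directional_MVT], known only up to the length of the segment, then stay within [3 * r] of
    [u0]. *)
Hypothesis Orect : forall u w, `|u - u0| <= 3 * r -> `|w - w0| < r -> O (u, w).
Hypothesis Dpos : forall u w, `|u - u0| <= 3 * r -> `|w - w0| < r ->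
  0 < 'D_(1, 0) h (u, w).

Let addZ (a b a' b' t : R) :
  (a, b) + t *: (a', b') = (a + t * a', b + t * b') :> R * R.
Proof. by []. Qed.

Let strip (u w : R) := `|u - u0| <= r /\ `|w - w0| < r.

Let mono u u' w : strip u w -> strip u' w -> u < u' -> h (u, w) < h (u', w).
Proof.
move=> [ur wr] [ur' _] uu'.
have H (x : R) : `|x| <= `|u' - u| -> `|u + x - u0| <= 3 * r.
  rewrite [ `|u' - u|]gtr0_norm ?subr_gt0// => xs.
  move: ur ur' xs; rewrite !ler_norml => /andP[? ?] /andP[? ?] /andP[? ?].
  by apply/andP; split; lra.
have P (x : R) : (u, w) + x *: (1, 0) = (u + x, w) :> R * R.
  by rewrite addZ mulr1 mulr0 addr0.
have [|x xs] := @directional_MVT _ _ h (u, w) ((1, 0) : R * R) (u' - u).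
  move=> x xs; rewrite P.
  by case: (Cn_is_derive ((1, 0) : R * R) (Ch 1) (Orect (H _ xs) wr)).
rewrite !P [u + (_ - _)]addrC subrK => E.
by rewrite -subr_gt0 E mulr_gt0 ?subr_gt0//; exact: Dpos (H _ xs) wr.
Qed.

Let mono_le u u' w : strip u w -> strip u' w -> h (u, w) < h (u', w) -> u < u'.
Proof.
move=> su su'; apply: contraTT; rewrite -!leNgt le_eqVlt => /orP[/eqP->//|].
by move=> /(mono su' su)/ltW.
Qed.

Let inj u u' w : strip u w -> strip u' w -> h (u, w) = h (u', w) -> u = u'.
Proof.
move=> su su' E; case: (ltgtP u u') => //.
  by move=> /(mono su su'); rewrite E ltxx.
by move=> /(mono su' su); rewrite E ltxx.
Qed.

Let hO u w : strip u w -> O (u, w).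
Proof.
by move=> [ur wr]; apply: Orect => //; apply: le_trans ur _; move: r0; lra.
Qed.

Let endl w : `|w - w0| < r -> strip (u0 - r) w.
Proof. by move=> wr; split=> //; rewrite addrAC subrr sub0r normrN gtr0_norm. Qed.

Let endr w : `|w - w0| < r -> strip (u0 + r) w.
Proof. by move=> wr; split=> //; rewrite addrAC subrr add0r gtr0_norm. Qed.

(** By monotonicity and the intermediate value theorem this is the image of the open rectangle of
    half-width [r] under [(u, w) |-> (h (u, w), w)]. Described by inequalities, it is visibly
    open. *)
Let T : set (R * R) :=
  [set q | [/\ `|q.2 - w0| < r, h (u0 - r, q.2) < q.1 & q.1 < h (u0 + r, q.2)]].

(** A choice of root in the fibre, with 0 as default when there is none; over [T] the root exists
    and is unique. *)
Let k (q : R * R) : R := xget 0 [set u | `|u - u0| < r /\ h (u, q.2) = q.1].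

Let kP q : T q -> `|k q - u0| < r /\ h (k q, q.2) = q.1.
Proof.
move=> [wr ql qr]; apply: (@xgetPex _ 0 [set u | `|u - u0| < r /\ h (u, q.2) = q.1]).
have ch : {within `[u0 - r, u0 + r], continuous (fun u => h (u, q.2))}.
  apply: continuous_in_subspaceT => u; rewrite inE /= in_itv /= => /andP[ul ur].
  apply: (@continuous_comp _ _ _ (fun u => (u, q.2)) h).
    by apply: cvg_to_pair; [exact: cvg_id|exact: cvg_cst].
  apply: (Cn_continuous (Ch 0)); apply: hO; split=> //.
  by rewrite ler_norml; apply/andP; split; move: r0; lra.
have [||u] := @IVT _ _ _ _ q.1 _ ch; first by move: r0; lra.
  by rewrite ge_min le_max (ltW ql) (ltW qr) orbT.
rewrite in_itv /= => /andP[ul ur] E; exists u; split=> //.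
have su : strip u q.2 by split=> //; rewrite ler_norml; apply/andP; split; move: r0; lra.
rewrite -E in ql qr; have := mono_le (endl wr) su ql.
by have := mono_le su (endr wr) qr; rewrite ltr_norml => ? ?; apply/andP; split; move: r0; lra.
Qed.

Let skq q : T q -> strip (k q) q.2.
Proof. by move=> /[dup] [[? _ _]] /kP[/ltW]. Qed.

Let kK u w : `|u - u0| < r -> `|w - w0| < r -> T (h (u, w), w) /\ k (h (u, w), w) = u.
Proof.
move=> ur wr; have su : strip u w by split=> //; exact: ltW.
have Tq : T (h (u, w), w).
  split=> //=; [apply: mono => //; first exact: endl|apply: mono => //; first exact: endr];
    by move: ur; rewrite ltr_norml => /andP[? ?]; move: r0; lra.
by split=> //; have [_] := kP Tq; apply: inj => //; exact: skq Tq.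
Qed.

Let near_slice u (q : R * R) : O (u, q.2) ->
  (fun q' : R * R => h (u, q'.2)) @ q --> h (u, q.2).
Proof.
move=> Ou; apply: (@continuous_comp _ _ _ (fun q' : R * R => (u, q'.2)) h).
  by apply: cvg_to_pair; [exact: cvg_cst|exact: cvg_snd].
exact: (Cn_continuous (Ch 0)).
Qed.

Let near_gt u (q : R * R) : O (u, q.2) -> h (u, q.2) < q.1 ->
  \forall q' \near q, h (u, q'.2) < q'.1.
Proof.
move=> Ou hq; near=> q'; rewrite -subr_gt0; near: q'.
apply: (cvgr_gt (q.1 - h (u, q.2))); last by rewrite subr_gt0.
by apply: cvgB; [exact: cvg_fst|exact: near_slice].
Unshelve. all: by end_near. Qed.

Let near_lt u (q : R * R) : O (u, q.2) -> q.1 < h (u, q.2) ->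
  \forall q' \near q, q'.1 < h (u, q'.2).
Proof.
move=> Ou hq; near=> q'; rewrite -subr_gt0; near: q'.
apply: (cvgr_gt (h (u, q.2) - q.1)); last by rewrite subr_gt0.
by apply: cvgB; [exact: near_slice|exact: cvg_fst].
Unshelve. all: by end_near. Qed.

Let oT : open T.
Proof.
rewrite openE => q [wr ql qr]; rewrite /interior.
near=> q'; split; near: q'.
- apply: (cvgr_lt `|q.2 - w0|) => //; apply: cvg_norm.
  by apply: cvgB; [exact: cvg_snd|exact: cvg_cst].
- by apply: near_gt => //; apply: hO; exact: endl.
- by apply: near_lt => //; apply: hO; exact: endr.
Unshelve. all: by end_near. Qed.

Let nT q : T q -> nbhs q T.
Proof. by move=> Tq; apply: open_nbhs_nbhs; split=> //; exact: oT. Qed.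

(** The strict inequalities [h (k q - d, w) < y < h (k q + d, w)] persist for [(y, w)] near [q], and
    monotonicity of [h] turns them into [k q - d < k (y, w) < k q + d]. *)
Let ck q : T q -> {for q, continuous k}.
Proof.
move=> Tq; have [kr hk] := kP Tq; have [wr _ _] := Tq.
apply/cvgrPdist_lt => eps eps0.
(* This margin is smaller than [eps] and keeps [k q - d] and [k q + d] in the strip where [h] is
   monotone; halving makes both bounds strict. *)
pose d := Num.min eps (r - `|k q - u0|) / 2.
have m0 : 0 < Num.min eps (r - `|k q - u0|) by rewrite lt_min eps0 subr_gt0.
have d0 : 0 < d by rewrite divr_gt0.
have [dle dlr] : d < eps /\ d < r - `|k q - u0|.
  have : d < Num.min eps (r - `|k q - u0|) by rewrite /d; move: r0; lra.
  by rewrite lt_min => /andP.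
have [nl nr] := (ler_norm (k q - u0), ler_norm (- (k q - u0))).
rewrite normrN in nr.
have sl w : `|w - w0| < r -> strip (k q - d) w.
  by move=> ?; split=> //; rewrite ler_norml; apply/andP; split; move: r0; lra.
have sr w : `|w - w0| < r -> strip (k q + d) w.
  by move=> ?; split=> //; rewrite ler_norml; apply/andP; split; move: r0; lra.
have Nl : \forall q' \near q, h (k q - d, q'.2) < q'.1.
  apply: near_gt; first by apply: hO; exact: sl.
  by rewrite -hk; apply: mono; [exact: sl|exact: skq|lra].
have Nr : \forall q' \near q, q'.1 < h (k q + d, q'.2).
  apply: near_lt; first by apply: hO; exact: sr.
  by rewrite -hk; apply: mono; [exact: skq|exact: sr|lra].
near=> q'.
have Tq' : T q' by near: q'; exact: nT.
have [wr' _ _] := Tq'; have [_ hk'] := kP Tq'.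
have L : k q - d < k q'.
  by apply: (@mono_le _ _ q'.2); [exact: sl|exact: skq|rewrite hk'; near: q'].
have L' : k q' < k q + d.
  by apply: (@mono_le _ _ q'.2); [exact: skq|exact: sr|rewrite hk'; near: q'].
by rewrite ltr_norml; apply/andP; split; move: r0; lra.
Unshelve. all: by end_near. Qed.

Let Dk q : T q -> 'D_(1, 0) h (k q, q.2) != 0.
Proof.
move=> Tq; have [ur wr] := skq Tq; rewrite gt_eqF//; apply: Dpos => //.
by apply: le_trans ur _; move: r0; lra.
Qed.

(** Implicit differentiation with difference quotients: along [t *: v + q] the value of [h] at the
    root grows by [t * v.1]. This increment splits into a part in the parameter and a part in the
    first variable, and the latter is solved for the increment of [k]. *)
Let dk q v : T q -> is_derive q v k
  ((v.1 - v.2 * 'D_(0, 1) h (k q, q.2)) * ('D_(1, 0) h (k q, q.2))^-1).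
Proof.
move=> Tq; have [kr hk] := kP Tq; apply: is_derive_cvg.
pose y := (k q, q.2); have Oy : O y by apply/hO/skq.
have dh e : \forall x \near y, derivable h x e.
  near=> x; have Ox : O x by near: x; apply: open_nbhs_nbhs; split=> //; exact: oO.
  by case: (Cn_is_derive e (Ch 1) Ox).
have cD e : {for y, continuous ('D_e h)}.
  exact: (Cn_continuous (Cn_derive e (Ch 1))).
pose s (t : R) := k (t *: v + q) - k q.
pose z (t : R) := (k q, t * v.2 + q.2).
have line := @cvg_along_line _ _ q v.
have s0 : s @ 0^' --> (0 : R).
  suff : s @ 0^' --> k q - k q by rewrite subrr.
  apply: cvgB; last exact: cvg_cst.
  exact: (cvg_comp _ _ line (ck Tq)).
have zy : z @ 0^' --> y.
  apply: cvg_to_pair; first exact: cvg_cst.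
  exact: (@cvg_along_line _ R q.2 v.2).
have b0 : (fun t : R => t * v.2) @ 0^' --> (0 : R).
  have := @cvg_along_line _ R 0 v.2; apply: cvg_trans; apply: near_eq_cvg.
  by near=> t; rewrite addr0.
have l1 := cvg_slope (e := (1, 0) : R * R) (dh _) (cD _) zy s0.
have l2 := cvg_slope (e := (0, 1) : R * R) (dh _) (cD _) (@cvg_cst _ y _ (0 : R)^' _) b0.
have L : (fun t => (v.1 - v.2 * slope h (0, 1) y (t * v.2)) *
    (slope h (1, 0) (z t) (s t))^-1) @ 0^' -->
    (v.1 - v.2 * 'D_(0, 1) h y) * ('D_(1, 0) h y)^-1.
  apply: cvgM; last by apply: cvgV; [exact: (Dk Tq)|exact: l1].
  by apply: cvgB; [exact: cvg_cst|apply: cvgM; [exact: cvg_cst|exact: l2]].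
(* The limit of this quotient is positive, so it can be divided by for small [t]. *)
have Nth : \forall t \near (0 : R)^', 0 < slope h (1, 0) (z t) (s t).
  apply: (cvgr_gt ('D_(1, 0) h y)); first exact: l1.
  by have [ur wr] := skq Tq; apply: Dpos => //; apply: le_trans ur _; move: r0; lra.
apply: cvg_trans L; apply: near_eq_cvg; near=> t.
have t0 : t != 0 by near: t; exact: nbhs_dnbhs_neq.
have th0 : slope h (1, 0) (z t) (s t) != 0.
  by rewrite gt_eqF//; near: t.
have Tt : T (t *: v + q) by near: t; apply: (line T); exact: nT.
have ht : h (k (t *: v + q), t * v.2 + q.2) = t * v.1 + q.1 := proj2 (kP Tt).
have E1 := slopeE h (1, 0) (z t) (s t).
have E2 := slopeE h (0, 1) y (t * v.2).
have Ez : z t + s t *: (1, 0) = (k (t *: v + q), t * v.2 + q.2).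
  by rewrite /z addZ mulr1 mulr0 addr0 /s [k q + _]addrC subrK.
have Ey : y + (t * v.2) *: (0, 1) = z t.
  by rewrite /y addZ mulr1 mulr0 addr0 [q.2 + _]addrC.
rewrite Ez ht in E1; rewrite Ey hk in E2.
transitivity (t^-1 * s t); last by [].
have hz : h (z t) = q.1 + t * v.2 * slope h (0, 1) y (t * v.2).
  by rewrite -E2 addrC subrK.
apply: (mulIf th0); rewrite divfK// -mulrA -E1 hz.
apply: (mulfI t0); rewrite mulrA mulfV// mul1r; ring.
Unshelve. all: by end_near. Qed.

(** Bootstrap: the formula for the derivative of [k] involves only [k] and derivatives of [h], so
    class C^n of [k] gives class C^(n+1). *)
Let Ck_k n : Cn n T k.
Proof.
elim: n => [|n IH]; first by split=> // q; exact: ck.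
have C2 : Cn n T (fun q => q.2).
  apply: (@Cn_linear _ _ _ _ _ (snd : {linear (R * R)%type -> R})) => //.
  by move=> x; exact: cvg_snd.
have CD e : Cn n T (fun q => 'D_e h (k q, q.2)).
  apply: (@Cn_comp2 _ _ _ _ O ('D_e h)) => //; first by move=> q /skq/hO.
  exact: (Cn_derive e (Ch n.+1)).
apply: (Cn_succ (df := fun v q : R * R => (v.1 - v.2 * 'D_(0, 1) h (k q, q.2)) *
   ('D_(1, 0) h (k q, q.2))^-1)) => // v.
apply: CnM => //; last by apply: CnV.
have C : Cn n T (fun q => v.1 + (- v.2) * 'D_(0, 1) h (k q, q.2)).
  apply: CnD => //; first exact: Cn_cst.
  by apply: CnM => //; exact: Cn_cst.
by apply: eq_Cn C => // q _; rewrite mulNr.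
Qed.

Lemma fibred_inverse_rect : exists k : R * R -> R,
  [/\ smooth_near k (h (u0, w0), w0),
      \forall p \near (u0, w0), k (h p, p.2) = p.1 &
      \forall q \near (h (u0, w0), w0), h (k q, q.2) = q.1].
Proof.
have z0 (x : R) : `|x - x| < r by rewrite subrr normr0.
have [T0 _] := kK (z0 u0) (z0 w0).
exists k; split.
- by apply/smooth_nearP; exists T; split.
- exists (ball u0 r, ball w0 r) => /=.
    by split; exact: nbhsx_ballx.
  move=> [u w] /= [ur wr]; apply: (proj2 (kK _ _)).
    by rewrite distrC; exact: ur.
  by rewrite distrC; exact: wr.
- near=> q; have Tq : T q by near: q; exact: nT.
  by have [] := kP Tq.
Unshelve. all: by end_near. Qed.

End FibredInverse.

Section FibredInverseTheorem.
Context {R : realType}.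

Let fibred_inverse_pos (h : R * R -> R) (p0 : R * R) :
  smooth_near h p0 -> 0 < 'D_(1, 0) h p0 -> exists k : R * R -> R,
  [/\ smooth_near k (h p0, p0.2),
      \forall p \near p0, k (h p, p.2) = p.1 &
      \forall q \near (h p0, p0.2), h (k q, q.2) = q.1].
Proof.
case: p0 => u0 w0 sh D0.
have cD := smooth_near_continuous (smooth_near_derive ((1, 0) : R * R) sh).
have nD : \forall p \near (u0, w0), 0 < 'D_(1, 0) h p by exact: cvgr_gt cD _ D0.
move/smooth_nearP : sh => [B [Ba oB Ch]].
have nO : nbhs (u0, w0) B by exact: open_nbhs_nbhs.
have /nbhs_ballP[r /= r0 rP] : nbhs (u0, w0) [set p | B p /\ 0 < 'D_(1, 0) h p].
  exact: filterI.
(* A quarter of the radius is taken because the rectangle must have half-width three times the new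
   [r]. *)
have P u w : `|u - u0| <= 3 * (r / 4) -> `|w - w0| < r / 4 ->
    B (u, w) /\ 0 < 'D_(1, 0) h (u, w).
  move=> ur wr; apply: rP; split; rewrite -ball_normE /= distrC.
    by apply: le_lt_trans ur _; lra.
  by apply: lt_le_trans wr _; lra.
apply: (@fibred_inverse_rect _ h u0 w0 (r / 4) B) => //; first by lra.
  by move=> u w ? ?; case: (P u w).
by move=> u w ? ?; case: (P u w).
Qed.

(** A negative derivative is reduced to a positive one by inverting [- h] and reflecting the first
    variable of the inverse. In other terms, [(u, w) |-> (h (u, w), w)] is a local diffeomorphism
    with inverse [(y, w) |-> (k (y, w), w)]. *)
Theorem fibred_inverse (h : R * R -> R) (p0 : R * R) :
  smooth_near h p0 -> 'D_(1, 0) h p0 != 0 -> exists k : R * R -> R,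
  [/\ smooth_near k (h p0, p0.2),
      \forall p \near p0, k (h p, p.2) = p.1 &
      \forall q \near (h p0, p0.2), h (k q, q.2) = q.1].
Proof.
move=> sh; rewrite neq_lt => /orP[D0|]; last exact: fibred_inverse_pos sh.
have [|k [sk kh hk]] := fibred_inverse_pos (smooth_nearN sh).
  by rewrite (deriveN (smooth_near_derivable sh)) oppr_gt0.
have cN : (fun q : R * R => (- q.1, q.2)) @ (h p0, p0.2) --> (- h p0, p0.2).
  by apply: cvg_to_pair; [apply: cvgN; exact: cvg_fst|exact: cvg_snd].
exists (fun q => k (- q.1, q.2)); split=> //.
- apply: (@smooth_near_comp2 _ _ k (fun q => - q.1) (fun q => q.2)) => //;
    last exact: smooth_near_snd.
  by apply: smooth_nearN; exact: smooth_near_fst.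
- have N : \forall q \near (h p0, p0.2), - h (k (- q.1, q.2), q.2) = - q.1 := cN _ hk.
  apply: filterS N => q /eqP.
  by rewrite eqr_oppLR opprK => /eqP.
Qed.

End FibredInverseTheorem.

(** * Diffeomorphism germs and a criterion for cuspidal cross caps *)

Section CuspidalCrossCap.
Context {R : realType}.

(** A diffeomorphism germ requires two open sets that the maps exchange exactly. Cutting each
    neighbourhood by the preimage of the other achieves this, since the maps are mutually inverse on
    both. *)
Lemma diffeo_germ_near (V : normedModType R) (phi chi : V -> V) (p : V) :
  smooth_near phi p -> smooth_near chi (phi p) ->
  (\forall x \near p, chi (phi x) = x) ->
  (\forall y \near phi p, phi (chi y) = y) -> diffeo_germ phi p.
Proof.
move=> /smooth_nearP[U1 [U1p o1 C1]] /smooth_nearP[U2 [U2p o2 C2]] chiK phiK.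
have oI (W : normedModType R) (f : W -> W) (A B : set W) : open A -> open B ->
    (forall x, A x -> {for x, continuous f}) -> open (A `&` f @^-1` B).
  move=> oA oB cf; rewrite openE => x [Ax Bx]; apply: filterI.
    exact: open_nbhs_nbhs.
  by apply: (cf x Ax); exact: open_nbhs_nbhs.
pose A := U1 `&` (fun x => chi (phi x) = x)^°.
pose B := U2 `&` (fun y => phi (chi y) = y)^°.
have oA : open A by apply: openI => //; exact: open_interior.
have oB : open B by apply: openI => //; exact: open_interior.
have AP x : A x -> chi (phi x) = x by move=> [_ /interior_subset].
have BP y : B y -> phi (chi y) = y by move=> [_ /interior_subset].
exists (A `&` phi @^-1` B), (B `&` chi @^-1` A), chi; split.
- by split; split.
- split; last by move=> k; apply: Cn_Ck; apply: Cn_subset (C1 k) => x [[]].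
  by apply: oI => // x [U1x _]; exact: Cn_continuous (C1 0) _ U1x.
- split; last by move=> k; apply: Cn_Ck; apply: Cn_subset (C2 k) => x [[]].
  by apply: oI => // x [U2x _]; exact: Cn_continuous (C2 0) _ U2x.
- by move=> x [Ax Bx]; have E := AP _ Ax; do 2?split=> //; rewrite /= E.
- by move=> y [By Ay]; have E := BP _ By; do 2?split=> //; rewrite /= E.
Qed.

Lemma smooth_near_preim (V W : normedModType R) (f : V -> W) (a : V)
    (P : W -> Prop) : smooth_near f a -> (\forall y \near f a, P y) ->
  \forall x \near a, P (f x).
Proof. by move=> /smooth_near_continuous; exact. Qed.

Lemma derive_fst_slice (h : R * R -> R) (c : R -> R) (u0 w0 : R) :
  (forall u, h (u, w0) = c u) -> derivable c u0 1 ->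
  'D_(1, 0) h (u0, w0) = 'D_1 c u0.
Proof.
move=> hc dc; apply: derive_val; apply: is_derive_cvg.
have /cvg_is_derive := derivableP dc; apply: cvg_trans; apply: near_eq_cvg.
near=> t; congr (_ *: (_ - _)); last by rewrite hc.
rewrite -hc; congr (h (_, _)); rewrite /= ?scaler0 ?add0r//.
Unshelve. all: by end_near. Qed.

(** A simple zero of the coefficient [C1] of [v^3] makes [h (u, w) = C1 u + w * C3 (u, w)] usable as
    a coordinate in place of [u]; the term [v^3 * h (u, v^2)] then becomes [v^3] times the first
    coordinate. *)
Lemma cuspidal_cross_cap_normal (A B C0 C1 : R -> R) (C2 C3 : R * R -> R)
    (g : R * R -> R * R * R) (u0 : R) :
  smooth_near A u0 -> smooth_near B u0 -> smooth_near C0 u0 ->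
  smooth_near C1 u0 -> smooth_near C2 (u0, 0) -> smooth_near C3 (u0, 0) ->
  C1 u0 = 0 -> 'D_1 C1 u0 != 0 ->
  (forall u v, g (u, v) = (u, A u + v ^+ 2, B u + v ^+ 2 *
     (C0 u + v * C1 u + v ^+ 2 * C2 (u, v ^+ 2) + v ^+ 3 * C3 (u, v ^+ 2)))) ->
  cuspidal_cross_cap g (u0, 0).
Proof.
move=> sA sB s0 s1 s2 s3 C10 DC1 gE.
pose h (p : R * R) := C1 p.1 + p.2 * C3 (p.1, p.2).
have sh : smooth_near h (u0, 0).
  apply: smooth_nearD.
    by apply: (smooth_near_comp1 (a := (u0, 0) : R * R)) => //; exact: smooth_near_fst.
  apply: smooth_nearM; first exact: smooth_near_snd.
  by apply: (smooth_near_comp2 (a := (u0, 0) : R * R)) => //;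
    [exact: smooth_near_fst|exact: smooth_near_snd].
have h0 : h (u0, 0) = 0 by rewrite /h /= mul0r addr0.
have Dh : 'D_(1, 0) h (u0, 0) != 0.
  rewrite (@derive_fst_slice _ C1)//; last exact: smooth_near_derivable.
  by move=> u; rewrite /h /= mul0r addr0.
have [k [sk kh hk]] := fibred_inverse sh Dh.
rewrite /= h0 in sk hk.
have k0 : k (0, 0) = u0.
  by have := nbhs_singleton kh; rewrite /= h0.
(* As [h] is evaluated at parameter [v^2] and [v] is kept, the fibred inverse [k] at the same
   parameter inverts this change of source coordinates. *)
pose phi (p : R * R) := (h (p.1, p.2 ^+ 2), p.2).
pose chi (q : R * R) := (k (q.1, q.2 ^+ 2), q.2).
(* On the image of [g] one has [Y = v^2], so the terms with [C0] and [C2] are functions of the first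
   two target coordinates and can be subtracted, along with [B]. *)
pose psi (P : R * R * R) := let Y := P.1.2 - A P.1.1 in
  (h (P.1.1, Y), Y, P.2 - (B P.1.1 + Y * (C0 P.1.1 + Y * C2 (P.1.1, Y)))).
pose psi' (Q : R * R * R) := let X := k (Q.1.1, Q.1.2) in
  (X, Q.1.2 + A X, Q.2 + (B X + Q.1.2 * (C0 X + Q.1.2 * C2 (X, Q.1.2)))).
have g0 : g (u0, 0) = (u0, A u0, B u0).
  by rewrite gE expr0n /= mul0r !addr0.
have psi0 : psi (g (u0, 0)) = (0, 0, 0).
  by rewrite g0 /psi /= subrr h0 mul0r addr0 subrr.
have sfst2 (a : R * R * R) : smooth_near (fun P : R * R * R => P.1.1) a.
  by apply: (@smooth_near_linear _ _ _ (fst \o fst : {linear (R * R * R)%type -> R})) => x;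
    apply: continuous_comp; exact: cvg_fst.
have ssnd2 (a : R * R * R) : smooth_near (fun P : R * R * R => P.1.2) a.
  by apply: (@smooth_near_linear _ _ _ (snd \o fst : {linear (R * R * R)%type -> R})) => x;
    apply: continuous_comp; [exact: cvg_fst|exact: cvg_snd].
have sphi2 (a : R * R) : smooth_near (fun p : R * R => p.2 ^+ 2) a.
  by apply: smooth_nearX; exact: smooth_near_snd.
have smap (a : R * R) : smooth_near (fun p : R * R => (p.1, p.2 ^+ 2)) a.
  by apply: smooth_near_pair => //; exact: smooth_near_fst.
exists phi, psi; split.
- apply: (@diffeo_germ_near _ _ chi).
  + apply: smooth_near_pair; last exact: smooth_near_snd.
    apply: smooth_near_comp2 => //; last exact: smooth_near_fst.
    by rewrite /= expr0n.
  + rewrite /phi /= expr0n /= h0; apply: smooth_near_pair; last exact: smooth_near_snd.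
    apply: smooth_near_comp2 => //; last exact: smooth_near_fst.
    by rewrite /= expr0n.
  + have : \forall p \near (u0, 0 : R), k (h (p.1, p.2 ^+ 2), p.2 ^+ 2) = p.1.
      by apply: (smooth_near_preim (P := fun p => k (h p, p.2) = p.1) (smap (u0, 0)));
        rewrite /= expr0n.
    by apply: filterS => -[u v] /= E; rewrite /chi /phi /= E.
  + rewrite /phi /= expr0n /= h0.
    have : \forall q \near (0 : R, 0 : R), h (k (q.1, q.2 ^+ 2), q.2 ^+ 2) = q.1.
      by apply: (smooth_near_preim (P := fun q => h (k q, q.2) = q.1) (smap (0, 0)));
        rewrite /= expr0n.
    by apply: filterS => -[u v] /= E; rewrite /chi /= E.
- by rewrite /phi /= expr0n /= h0.
- have sY : smooth_near (fun P : R * R * R => P.1.2 - A P.1.1) (u0, A u0, B u0).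
    by apply: smooth_nearB => //; exact: smooth_near_comp1.
  have sXY : smooth_near (fun P : R * R * R => (P.1.1, P.1.2 - A P.1.1)) (u0, A u0, B u0).
    exact: smooth_near_pair.
  have sX' : smooth_near (fun Q : R * R * R => k (Q.1.1, Q.1.2)) (0, 0, 0).
    exact: smooth_near_comp2.
  rewrite g0; apply: (@diffeo_germ_near _ _ psi').
  + apply: smooth_near_pair; first apply: smooth_near_pair => //.
      by apply: smooth_near_comp2 => //=; rewrite subrr.
    apply: smooth_nearB; first exact: smooth_near_snd.
    apply: smooth_nearD; first exact: smooth_near_comp1.
    apply: smooth_nearM => //; apply: smooth_nearD; first exact: smooth_near_comp1.
    by apply: smooth_nearM => //; apply: smooth_near_comp2 => //=; rewrite subrr.
  + rewrite -g0 psi0; apply: smooth_near_pair; first apply: smooth_near_pair => //.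
      by apply: smooth_nearD => //; apply: smooth_near_comp1 => //=; rewrite k0.
    apply: smooth_nearD; first exact: smooth_near_snd.
    apply: smooth_nearD; first by apply: smooth_near_comp1 => //=; rewrite k0.
    apply: smooth_nearM => //; apply: smooth_nearD.
      by apply: smooth_near_comp1 => //=; rewrite k0.
    by apply: smooth_nearM => //; apply: smooth_near_comp2 => //=; rewrite k0.
  + have : \forall P \near (u0, A u0, B u0),
        k (h (P.1.1, P.1.2 - A P.1.1), P.1.2 - A P.1.1) = P.1.1.
      by apply: (smooth_near_preim (P := fun p => k (h p, p.2) = p.1) sXY); rewrite /= subrr.
    apply: filterS => -[[X Y] Z] /= E; rewrite /psi' /psi /= E.
    by rewrite !subrK.
  + rewrite -g0 psi0.
    have : \forall Q \near (0 : R, 0 : R, 0 : R), h (k Q.1, Q.1.2) = Q.1.1.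
      exact: (smooth_near_preim (@smooth_near_fst _ (R * R)%type R (0, 0, 0)) hk).
    apply: filterS => -[[X Y] Z] /= E; rewrite /psi' /psi /=.
    by rewrite !addrK E.
- by rewrite psi0 /ccr_std /= expr0n mulr0.
(* Both sides equal [(h (u, v^2), v^2, v^3 * h (u, v^2))]. *)
- apply: filterE => -[u v]; rewrite gE /psi /ccr_std /phi /=.
  rewrite [A u + _]addrC addrK; congr (_, _, _); rewrite /h /=; ring.
Qed.

End CuspidalCrossCap.

(** * Bounded functions near 0 and Taylor remainders *)

Section BoundedGerms.
Context {R : realType}.

(** Stands for O(1). For the order estimates, boundedness of the Taylor quotients suffices and is
    easier to obtain than their smoothness. *)
Definition bounded_near0 (f : R -> R) :=
  exists M : R, \forall t \near 0, `|f t| <= M.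

Lemma bounded_near0_cvg (f : R -> R) (l : R) : f @ (0 : R) --> l -> bounded_near0 f.
Proof.
move=> fl; exists (1 + `|l|); near=> t.
have : `|l - f t| < 1 by near: t; move/cvgrPdist_lt : fl => /(_ 1 ltr01).
by move=> /ltW lt1; rewrite -[f t](subrK l) (le_trans (ler_normD _ _))// distrC lerD2r.
Unshelve. all: by end_near. Qed.

Lemma bounded_near0_smooth (f : R -> R) : smooth_near f 0 -> bounded_near0 f.
Proof. by move=> /smooth_near_continuous; exact: bounded_near0_cvg. Qed.

Lemma bounded_near0D (f g : R -> R) : bounded_near0 f -> bounded_near0 g ->
  bounded_near0 (fun t => f t + g t).
Proof.
move=> [M fM] [N gN]; exists (M + N); near=> t.
by rewrite (le_trans (ler_normD _ _))// lerD//; near: t.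
Unshelve. all: by end_near. Qed.

Lemma bounded_near0M (f g : R -> R) : bounded_near0 f -> bounded_near0 g ->
  bounded_near0 (fun t => f t * g t).
Proof.
move=> [M fM] [N gN]; exists (M * N); near=> t.
by rewrite normrM ler_pM//; near: t.
Unshelve. all: by end_near. Qed.

Lemma bounded_near0_comp (f s : R -> R) : s @ (0 : R) --> (0 : R) ->
  bounded_near0 f -> bounded_near0 (fun t => f (s t)).
Proof. by move=> s0 [M fM]; exists M; exact: (s0 _ fM). Qed.

Lemma Taylor1_near0 (f : R -> R) : smooth_near f 0 ->
  exists2 q, bounded_near0 q & forall x, f x = f 0 + x * q x.
Proof.
move=> sf; exists (slope f 1 0).
  apply: (@bounded_near0_cvg _ ('D_1 f 0)).
  apply: cvg_slope; [|exact/smooth_near_continuous/smooth_near_derive|exact: cvg_cst|exact: cvg_id].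
  by apply: filterS (smooth_near_near sf) => x; exact: smooth_near_derivable.
move=> x; have := slopeE f 1 0 x; rewrite add0r [x *: 1]mulr1 => <-.
by rewrite addrC subrK.
Qed.

(** The mean value theorem gives [f x - f 0 = x * f'(y)] with [|y| <= |x|], and the first-order
    expansion of the derivative gives [f'(y) - f'(0) = y * q' y]; hence the quotient by [x^2] is
    bounded by the bound of [q']. *)
Lemma Taylor2_near0 (f : R -> R) : smooth_near f 0 ->
  exists2 q, bounded_near0 q & forall x, f x = f 0 + x * 'D_1 f 0 + x ^+ 2 * q x.
Proof.
move=> sf; have [q' [M q'M] Dq] := Taylor1_near0 (smooth_near_derive (1 : R) sf).
exists (fun x => if x == 0 then 0 else (f x - f 0 - x * 'D_1 f 0) / x ^+ 2); last first.
  move=> x; case: eqP => [->|/eqP x0]; first by rewrite !(mul0r, expr0n, addr0, mulr0).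
  by rewrite [x ^+ 2 * _]mulrC divfK ?expf_neq0//; ring.
have /nbhs_norm0P[r /= r0 rP] : \forall x \near (0 : R), derivable f x 1 /\ `|q' x| <= M.
  near=> x; split; last by near: x.
  by apply: smooth_near_derivable; near: x; exact: smooth_near_near sf.
exists M; apply/nbhs_norm0P; exists r => //= x xr.
have M0 : 0 <= M.
  have [_] : derivable f 0 1 /\ `|q' 0| <= M by apply: rP => /=; rewrite normr0.
  exact: le_trans.
case: eqP => [_|/eqP x0]; first by rewrite normr0.
have P (y : R) : 0 + y *: 1 = y by rewrite add0r [y *: 1]mulr1.
have [|y yx] := @directional_MVT _ _ f 0 1 x.
  by move=> y yx; rewrite P; case: (rP y (le_lt_trans yx xr)).
rewrite !P Dq => ->.
rewrite mulrDr addrAC subrr add0r normrM normfV normrX !normrM.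
have [_ q'y] := rP y (le_lt_trans yx xr).
rewrite ler_pdivrMr ?exprn_gt0 ?normr_gt0//.
have -> : M * `|x| ^+ 2 = `|x| * (`|x| * M) by ring.
by rewrite ler_wpM2l// ler_pM.
Unshelve. all: by end_near. Qed.

End BoundedGerms.

(** * Factorization of [c1] along [s = - t^2] *)

Section SingularCurve.
Context {R : realType}.
Variables (d1 d2 d3 : R -> R) (d4 : R * R -> R).
Hypotheses (s1 : smooth_near d1 0) (s2 : smooth_near d2 0)
  (s3 : smooth_near d3 0) (s4 : smooth_near d4 (0, 0)) (d2_gt0 : 0 < d2 0).

Let c1 := c1_of d1 d2 d3 d4.
Let z2 : R * R := (0, 0).

(** These are [D], [E] and [G] of the outline: [c1 (u, - t^2)] is
    [u^2 * quad_part - t^2 * unit_part]. Both parts are even in [t], so replacing [t] by [- t] in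
    [half_root] only changes the sign between its two terms. *)
Definition quad_part (p : R * R) : R :=
  d2 (- p.2 ^+ 2) + p.1 * d3 (- p.2 ^+ 2) + p.1 ^+ 2 * d4 (p.1, - p.2 ^+ 2).
Definition unit_part (p : R * R) : R := 1 + p.1 * d1 (- p.2 ^+ 2).
Definition half_root (p : R * R) : R :=
  p.1 * Num.sqrt (quad_part p) - p.2 * Num.sqrt (unit_part p).

Lemma quad_part0 : quad_part (0, 0) = d2 0.
Proof. by rewrite /quad_part /= expr0n oppr0 !mul0r !addr0. Qed.

Lemma unit_part0 : unit_part (0, 0) = 1.
Proof. by rewrite /unit_part /= mul0r addr0. Qed.

Lemma half_root0 : half_root (0, 0) = 0.
Proof. by rewrite /half_root /= !mul0r subr0. Qed.

Let sN : smooth_near (fun p : R * R => - p.2 ^+ 2) z2.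
Proof. by apply: smooth_nearN; apply: smooth_nearX; exact: smooth_near_snd. Qed.

Let s1N (f : R -> R) : smooth_near f 0 -> smooth_near (fun p : R * R => f (- p.2 ^+ 2)) z2.
Proof. by move=> sf; apply: smooth_near_comp1 => //=; rewrite expr0n oppr0. Qed.

Let s1fst : smooth_near (fun p : R * R => p.1) z2.
Proof. exact: smooth_near_fst. Qed.

Lemma smooth_quad_part : smooth_near quad_part (0, 0).
Proof.
apply: smooth_nearD; first apply: smooth_nearD; first exact: s1N.
  by apply: smooth_nearM; [exact: s1fst|exact: s1N].
apply: smooth_nearM; first by apply: smooth_nearX; exact: s1fst.
apply: smooth_near_comp2; [|exact: s1fst|exact: sN].
by rewrite /= expr0n oppr0.
Qed.

Lemma smooth_unit_part : smooth_near unit_part (0, 0).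
Proof.
apply: smooth_nearD; first exact: smooth_near_cst.
by apply: smooth_nearM; [exact: s1fst|exact: s1N].
Qed.

Lemma smooth_half_root : smooth_near half_root (0, 0).
Proof.
apply: smooth_nearB; apply: smooth_nearM; try exact: s1fst; try exact: smooth_near_snd.
  by apply: smooth_near_sqrt; [rewrite quad_part0|exact: smooth_quad_part].
by apply: smooth_near_sqrt; [rewrite unit_part0|exact: smooth_unit_part].
Qed.

Lemma near_unit_part_gt0 : \forall p \near z2, 0 < unit_part p.
Proof.
have := smooth_near_continuous smooth_unit_part.
by move=> c; apply: (cvgr_gt _ c); rewrite unit_part0.
Qed.

Lemma near_quad_part_gt0 : \forall p \near z2, 0 < quad_part p.
Proof.
have := smooth_near_continuous smooth_quad_part.
by move=> c; apply: (cvgr_gt _ c); rewrite quad_part0.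
Qed.

Lemma half_rootN u t : half_root (u, - t) =
  u * Num.sqrt (quad_part (u, t)) + t * Num.sqrt (unit_part (u, t)).
Proof. by rewrite /half_root /quad_part /unit_part /= sqrrN mulNr opprK. Qed.

(** A difference of two squares; positivity of both parts near the origin lets the square roots be
    squared back. *)
Lemma near_c1_factor : \forall p \near z2,
  c1 (p.1, - p.2 ^+ 2) = half_root p * half_root (p.1, - p.2).
Proof.
near=> p; have D0 : 0 <= quad_part p by apply/ltW; near: p; exact: near_quad_part_gt0.
have E0 : 0 <= unit_part p by apply/ltW; near: p; exact: near_unit_part_gt0.
rewrite half_rootN -surjective_pairing /half_root -subr_sqr !exprMn !sqr_sqrtr//.
rewrite /c1 /c1_of /quad_part /unit_part /=; ring.
Unshelve. all: by end_near. Qed.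

(** On the slice [t = 0] the function is [u * g u], whose derivative at 0 is [g 0], the square root
    of [d2 0]. *)
Lemma derive_half_root_neq0 : 'D_(1, 0) half_root (0, 0) != 0.
Proof.
pose g (u : R) : R := Num.sqrt (quad_part (u, 0)).
have sg : smooth_near g 0.
  apply: smooth_near_sqrt; first by rewrite quad_part0.
  apply: smooth_near_comp2; first exact: smooth_quad_part.
    exact: smooth_near_id.
  exact: smooth_near_cst.
have sM : smooth_near (fun u : R => u * g u) 0.
  by apply: smooth_nearM => //; exact: smooth_near_id.
rewrite (@derive_fst_slice _ _ (fun u : R => u * g u)); last 2 first.
- by move=> u; rewrite /half_root /= mul0r subr0.
- exact: smooth_near_derivable.
have := deriveM (@derivable_id R R 0 1) (smooth_near_derivable (v := 1 : R) sg).
rewrite scale0r add0r derive_id [_ *: 1]mulr1 => E.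
have -> : 'D_1 (fun u : R => u * g u) 0 = g 0 by rewrite -E.
by rewrite gt_eqF// /g quad_part0 sqrtr_gt0.
Qed.

End SingularCurve.

(** * The third-order expansion of the branch *)

Section Expansion.
Context {R : realType}.
Variables (d1 d2 d3 : R -> R) (d4 : R * R -> R).
Hypotheses (s1 : smooth_near d1 0) (s2 : smooth_near d2 0)
  (s3 : smooth_near d3 0) (s4 : smooth_near d4 (0, 0)) (d2_gt0 : 0 < d2 0).

Let d20 : R := Num.sqrt (d2 0).
Let a1 : R := 1 / d20.
Let a2 := (d1 0 * d20 ^+ 2 - d3 0) / (2 * d20 ^+ 4).
Let a3 := ((d1 0 ^+ 2 + 4 * 'D_1 d2 0) * d20 ^+ 4
           - 2 * (3 * d1 0 * d3 0 + 2 * d4 (0, 0)) * d20 ^+ 2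
           + 5 * d3 0 ^+ 2) / (8 * d20 ^+ 7).

Let p (t : R) : R := a1 * t + a2 * t ^+ 2 + a3 * t ^+ 3.

Let d20_neq0 : d20 != 0.
Proof. by rewrite gt_eqF// sqrtr_gt0. Qed.

Let d20_sqr : d2 0 = d20 ^+ 2.
Proof. by rewrite sqr_sqrtr// ltW. Qed.

(** This and the next two identities are the vanishing of the coefficients of [t^2], [t^3] and [t^4]
    in [c1 (p t, - t^2)]; solved in turn, they determine [a1], [a2] and [a3]. *)
Let coef2 : a1 ^+ 2 * d2 0 - 1 = 0.
Proof. by rewrite d20_sqr /a1; field; exact: d20_neq0. Qed.

Let coef3 : - a1 * d1 0 + 2 * a1 * a2 * d2 0 + a1 ^+ 3 * d3 0 = 0.
Proof. by rewrite d20_sqr /a1 /a2; field; exact: d20_neq0. Qed.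

Let coef4 : - a2 * d1 0 + (a2 ^+ 2 + 2 * a1 * a3) * d2 0 - a1 ^+ 2 * 'D_1 d2 0
  + 3 * a1 ^+ 2 * a2 * d3 0 + a1 ^+ 4 * d4 (0, 0) = 0.
Proof. by rewrite d20_sqr /a1 /a2 /a3; field; exact: d20_neq0. Qed.

Let sp : smooth_near p 0.
Proof.
have C (c : R) n : smooth_near (fun t : R => c * t ^+ n) 0.
  apply: smooth_nearM; first exact: smooth_near_cst.
  by apply: smooth_nearX; exact: smooth_near_id.
by apply: smooth_nearD; first apply: smooth_nearD; [exact: (C _ 1%N)|exact: C|exact: C].
Qed.

Let sNsqr : smooth_near (fun t : R => - t ^+ 2) 0.
Proof. by apply: smooth_nearN; apply: smooth_nearX; exact: smooth_near_id. Qed.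

Let p0 : p 0 = 0.
Proof. by rewrite /p !expr0n /= !mulr0 !addr0. Qed.

Let Nsqr0 : (fun t : R => - t ^+ 2) @ (0 : R) --> (0 : R).
Proof. by have := smooth_near_continuous sNsqr; rewrite /prop_for /continuous_at expr0n oppr0. Qed.

Let c1 := c1_of d1 d2 d3 d4.

(** Each coefficient is expanded until its remainder contributes order at least 5 in [t]: first
    order for [d1] and [d3], second order for [d2], whose factor [u^2] is only of order 2, and first
    order in [t] for [d4] along the curve. *)
Lemma c1_approx_root : exists2 rho, bounded_near0 rho &
  forall t, c1 (p t, - t ^+ 2) = t ^+ 5 * rho t.
Proof.
have [q1 b1 E1] := Taylor1_near0 s1.
have [q2 b2 E2] := Taylor2_near0 s2.
have [q3 b3 E3] := Taylor1_near0 s3.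
have s4p : smooth_near (fun t => d4 (p t, - t ^+ 2)) 0.
  by apply: smooth_near_comp2 => //; rewrite p0 expr0n oppr0.
have [q4 b4 E4] := Taylor1_near0 s4p.
rewrite p0 expr0n oppr0 in E4.
pose sg (t : R) := a2 + a3 * t.
pose pi (t : R) : R := a1 + t * sg t.
(* The terms of order at least 5, divided by [t^5], that remain when the Taylor remainders are
   dropped; [pi t] is [p t / t] and [sg t] is [(pi t - a1) / t]. *)
pose S (t : R) := - a3 * d1 0 + (2 * a2 * a3 + t * a3 ^+ 2) * d2 0
  - (2 * a1 * sg t + t * sg t ^+ 2) * 'D_1 d2 0
  + (3 * a1 ^+ 2 * a3 + 3 * a1 * sg t ^+ 2 + t * sg t ^+ 3) * d3 0
  + (4 * a1 ^+ 3 * sg t + 6 * a1 ^+ 2 * t * sg t ^+ 2 + 4 * a1 * t ^+ 2 * sg t ^+ 3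
     + t ^+ 3 * sg t ^+ 4) * d4 (0, 0).
exists (fun t => S t + pi t * q1 (- t ^+ 2) + t * pi t ^+ 2 * q2 (- t ^+ 2)
  + (- pi t ^+ 3) * q3 (- t ^+ 2) + pi t ^+ 4 * q4 t); last first.
  move=> t; rewrite /c1 /c1_of /= E1 E2 E3 E4.
  apply/eqP; rewrite -subr_eq0; apply/eqP.
  transitivity (t ^+ 2 * (a1 ^+ 2 * d2 0 - 1)
    + t ^+ 3 * (- a1 * d1 0 + 2 * a1 * a2 * d2 0 + a1 ^+ 3 * d3 0)
    + t ^+ 4 * (- a2 * d1 0 + (a2 ^+ 2 + 2 * a1 * a3) * d2 0
        - a1 ^+ 2 * 'D_1 d2 0 + 3 * a1 ^+ 2 * a2 * d3 0 + a1 ^+ 4 * d4 (0, 0))).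
    by rewrite /S /pi /sg /p; clear; ring.
  by rewrite coef2 coef3 coef4 !mulr0 !addr0.
have sid : smooth_near (fun t : R => t) 0 by exact: smooth_near_id.
have sc (c : R) : smooth_near (fun t : R => c) 0 by exact: smooth_near_cst.
have ssg : smooth_near sg 0 by apply: smooth_nearD => //; exact: smooth_nearM.
have spi : smooth_near pi 0 by apply: smooth_nearD => //; exact: smooth_nearM.
have sS : smooth_near S 0.
  by rewrite /S; repeat (first [exact: sc | exact: sid | exact: ssg
    | apply: smooth_nearB | apply: smooth_nearD | apply: smooth_nearM
    | apply: smooth_nearX]).
apply: bounded_near0D; first apply: bounded_near0D; first apply: bounded_near0D;
  first apply: bounded_near0D; first exact: bounded_near0_smooth.
- apply: bounded_near0M; first exact: bounded_near0_smooth.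
  exact: bounded_near0_comp.
- apply: bounded_near0M; last exact: bounded_near0_comp.
  by apply: bounded_near0_smooth; apply: smooth_nearM => //; exact: smooth_nearX.
- apply: bounded_near0M; last exact: bounded_near0_comp.
  by apply: bounded_near0_smooth; apply: smooth_nearN; exact: smooth_nearX.
- by apply: bounded_near0M => //; apply: bounded_near0_smooth; exact: smooth_nearX.
Qed.

Let G := half_root d1 d2 d3 d4.

(** The other factor is [G (p t, - t) = t * beta t] with [beta 0 = a1 * d20 + 1 = 2], hence
    [beta > 1] near 0. Dividing [c1 (p t, - t^2) = t^5 * rho t] by it leaves order 4. *)
Lemma half_root_approx_root : exists M : R, \forall t \near 0, `|G (p t, t)| <= M * `|t| ^+ 4.
Proof.
have [rho [M rhoM] Erho] := c1_approx_root.
pose pi (t : R) : R := a1 + a2 * t + a3 * t ^+ 2.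
pose beta (t : R) : R := pi t * Num.sqrt (quad_part d2 d3 d4 (p t, t))
  + Num.sqrt (unit_part d1 (p t, t)).
have sid : smooth_near (fun t : R => t) 0 by exact: smooth_near_id.
have spi : smooth_near pi 0.
  apply: smooth_nearD; first apply: smooth_nearD; first exact: smooth_near_cst.
    by apply: smooth_nearM => //; exact: smooth_near_cst.
  by apply: smooth_nearM; [exact: smooth_near_cst|exact: smooth_nearX].
have sbeta : smooth_near beta 0.
  apply: smooth_nearD; first apply: smooth_nearM => //.
    apply: smooth_near_sqrt; first by rewrite p0 quad_part0.
    by apply: smooth_near_comp2 => //; rewrite p0; exact: smooth_quad_part.
  apply: smooth_near_sqrt; first by rewrite p0 unit_part0.
  by apply: smooth_near_comp2 => //; rewrite p0; exact: smooth_unit_part.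
have beta0 : beta 0 = 2.
  rewrite /beta p0 quad_part0 unit_part0 sqrtr1 /pi expr0n /= !mulr0 !addr0.
  by rewrite -/d20 /a1 div1r mulVf.
have beta1 : \forall t \near (0 : R), 1 < beta t.
  have c := smooth_near_continuous sbeta; apply: (cvgr_gt _ c).
  by rewrite beta0; lra.
have fac : \forall t \near (0 : R), c1 (p t, - t ^+ 2) = G (p t, t) * G (p t, - t).
  have st : smooth_near (fun t => (p t, t)) 0 by exact: smooth_near_pair.
  have := smooth_near_preim (P := fun x : R * R =>
    c1 (x.1, - x.2 ^+ 2) = G x * G (x.1, - x.2)) st.
  by rewrite p0 => /(_ (near_c1_factor s1 s2 s3 s4 d2_gt0)).
exists M; near=> t.
have E : t ^+ 5 * rho t = G (p t, t) * (t * beta t).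
  rewrite -Erho (near fac t)//; congr (_ * _).
  by rewrite /G half_rootN /beta /p /pi; ring.
have [->|t0] := eqVneq t 0; first by rewrite p0 /G half_root0 normr0 expr0n mulr0.
have {}E : G (p t, t) * beta t = t ^+ 4 * rho t.
  by apply: (mulfI t0); rewrite mulrCA -E; ring.
have b1 : 1 < beta t by near: t.
apply: (@le_trans _ _ (`|G (p t, t)| * `|beta t|)).
  by rewrite ler_peMr// ger0_norm; lra.
rewrite -normrM E normrM normrX mulrC ler_wpM2r ?exprn_ge0//.
by near: t.
Unshelve. all: by end_near. Qed.

End Expansion.

(** * The branch [u(t)], its error estimate, and the germs along it *)

Lemma near_neq0_itv {R : realType} {P : R -> Prop} :
  (\forall t \near (0 : R), t != 0 -> P t) ->
  exists e : R, 0 < e /\ forall t, 0 < `|t| < e -> P t.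
Proof.
move=> /nbhs_norm0P[e /= e0 eP]; exists e; split=> // t /andP[t0 te].
by apply: eP => //; rewrite -normr_gt0.
Qed.

Theorem theorem4p1 (R : realType)
  (f21 f31 : R -> R) (f24 f34 c0 : R * R -> R) (c2 c3 : R * R * R -> R)
  (d1 d2 d3 : R -> R) (d4 : R * R -> R) :
  smooth_near f21 0 -> smooth_near f31 0 ->
  smooth_near f24 (0, 0) -> smooth_near f34 (0, 0) -> smooth_near c0 (0, 0) ->
  smooth_near c2 (0, 0, 0) -> smooth_near c3 (0, 0, 0) ->
  smooth_near d1 0 -> smooth_near d2 0 -> smooth_near d3 0 ->
  smooth_near d4 (0, 0) ->
  c0 (0, 0) = 0 ->
  0 < d2 0 ->
  let c1 := c1_of d1 d2 d3 d4 in
  let f := f_map f21 f31 f24 f34 (f32_of c0 c1 c2 c3) in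
  let d20 := Num.sqrt (d2 0) in
  let a1 := 1 / d20 in
  let a2 := (d1 0 * d20 ^+ 2 - d3 0) / (2 * d20 ^+ 4) in
  let a3 := ((d1 0 ^+ 2 + 4 * derive1 d2 0) * d20 ^+ 4
             - 2 * (3 * d1 0 * d3 0 + 2 * d4 (0, 0)) * d20 ^+ 2
             + 5 * d3 0 ^+ 2) / (8 * d20 ^+ 7) in
  exists ut : R -> R,
    [/\ smooth_near ut 0,
        (* u(t~) = a1 t~ + a2 t~^2 + a3 t~^3 + O(t~^4) *)
        (exists C e : R, 0 < C /\ 0 < e /\
           forall t : R, `|t| < e ->
             `|ut t - (a1 * t + a2 * t ^+ 2 + a3 * t ^+ 3)| <= C * `|t| ^+ 4),
        (* near the origin, S_2(f) at s = -t~^2 is {v = 0, u = u(+-t~)} *)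
        (exists e dl : R, 0 < e /\ 0 < dl /\
           forall t u v : R, `|t| < e -> `|u| < dl -> `|v| < dl ->
             (S2 c1 (- t ^+ 2) (u, v) <-> v = 0 /\ (u = ut t \/ u = ut (- t)))) &
        (* both germs are cuspidal cross caps for small t~ <> 0 *)
        (exists e : R, 0 < e /\
           forall t : R, 0 < `|t| < e ->
             cuspidal_cross_cap (f (- t ^+ 2)) (ut t, 0) /\
             cuspidal_cross_cap (f (- t ^+ 2)) (ut (- t), 0))].
Proof.
move=> sf21 sf31 sf24 sf34 sc0 sc2 sc3 s1 s2 s3 s4 c00 d2_gt0.
move=> c1 f d20 a1 a2 a3; pose G := half_root d1 d2 d3 d4.
have sG : smooth_near G (0, 0) by exact: smooth_half_root.
have G0 : G (0, 0) = 0 by exact: half_root0.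
have DG0 : 'D_(1, 0) G (0, 0) != 0 by exact: derive_half_root_neq0.
have [k [sk kG Gk]] := fibred_inverse sG DG0.
rewrite -/G G0 /= in sk Gk.
pose ut (t : R) : R := k (0, t).
have sid : smooth_near (fun t : R => t) 0 by exact: smooth_near_id.
have s0t : smooth_near (fun t : R => (0 : R, t)) 0.
  by apply: smooth_near_pair => //; exact: smooth_near_cst.
have sut : smooth_near ut 0.
  by apply: smooth_near_comp2 => //; exact: smooth_near_cst.
have ut0 : ut 0 = 0 by have := nbhs_singleton kG; rewrite /= G0.
have Gut : \forall t \near (0 : R), G (ut t, t) = 0.
  by apply: (smooth_near_preim (P := fun q => G (k q, q.2) = q.1) s0t).
have fac : \forall p \near (0 : R, 0 : R),
    c1 (p.1, - p.2 ^+ 2) = G p * G (p.1, - p.2).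
  exact: near_c1_factor.
exists ut; split=> //.
- have [M GM] := half_root_approx_root s1 s2 s3 s4 d2_gt0.
  rewrite -/G -/d20 -/a1 -/a2 -derive1E -/a3 in GM.
  pose p (t : R) : R := a1 * t + a2 * t ^+ 2 + a3 * t ^+ 3.
  have sp : smooth_near p 0.
    have C (c : R) n : smooth_near (fun t : R => c * t ^+ n) 0.
      by apply: smooth_nearM; [exact: smooth_near_cst|exact: smooth_nearX].
    by apply: smooth_nearD; first apply: smooth_nearD;
      [exact: (C _ 1%N)|exact: C|exact: C].
  have p0 : p 0 = 0 by rewrite /p !expr0n /= !mulr0 !addr0.
  have spt : smooth_near (fun t : R => (p t, t)) 0 by exact: smooth_near_pair.
  pose x (t : R) : R := G (p t, t).
  have sx : smooth_near x 0 by apply: smooth_near_comp2 => //; rewrite p0.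
  have x0 : x 0 = 0 by rewrite /x p0.
  have kp : \forall t \near (0 : R), k (x t, t) = p t.
    apply: (smooth_near_preim (P := fun q => k (G q, q.2) = q.1) spt).
    by rewrite p0.
  (* Since [ut t = k (0, t)] and [p t = k (x t, t)], the error is [x t] times this slope of [k],
     which is bounded because it converges to a derivative of [k]. *)
  have [N HN] : bounded_near0 (fun t => slope k (1, 0) (0, t) (x t)).
    apply: (@bounded_near0_cvg _ _ ('D_(1, 0) k (0, 0))); apply: cvg_slope.
    + by apply: filterS (smooth_near_near sk) => q; exact: smooth_near_derivable.
    + exact/smooth_near_continuous/smooth_near_derive.
    + exact: smooth_near_continuous s0t.
    + by have := smooth_near_continuous sx; rewrite /prop_for /continuous_at x0.
  (* The bounds [M] and [N] carry no sign information, hence the absolute values; the summand 1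
     makes the constant positive. *)
  have H : \forall t \near (0 : R), `|ut t - p t| <= (1 + `|M| * `|N|) * `|t| ^+ 4.
    near=> t; have kpt : k (x t, t) = p t by near: t.
    have := slopeE k (1, 0) (0, t) (x t).
    have -> : (0, t) + x t *: (1, 0) = (0 + x t * 1, t + x t * 0) :> R * R by [].
    rewrite add0r mulr1 mulr0 addr0 kpt => E.
    rewrite distrC E normrM.
    apply: (@le_trans _ _ (M * `|t| ^+ 4 * N)).
      by apply: ler_pM => //; near: t.
    rewrite mulrAC ler_wpM2r ?exprn_ge0// -normrM.
    by apply: le_trans (ler_norm _) _; rewrite lerDr.
  move/nbhs_norm0P : H => [e /= e0 eP].
  exists (1 + `|M| * `|N|), e; split; first by rewrite ltr_pwDl// mulr_ge0.
  by split=> // t te; exact: eP.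
- have /nbhs_ballP[r /= r0 rP] : \forall p \near (0 : R, 0 : R),
      k (G p, p.2) = p.1 /\ c1 (p.1, - p.2 ^+ 2) = G p * G (p.1, - p.2).
    exact: filterI.
  have {}rP u t : `|u| < r -> `|t| < r -> k (G (u, t), t) = u /\
      c1 (u, - t ^+ 2) = G (u, t) * G (u, - t).
    move=> ur tr; apply: (rP (u, t)); split; rewrite -ball_normE /= sub0r normrN//.
  move/nbhs_norm0P : Gut => [e /= e0 eP].
  exists (Num.min e r), r; rewrite lt_min e0 r0; split=> //; split=> // t u v.
  rewrite lt_min => /andP[te tr] ur vr; rewrite /S2 /=.
  have [kt cf] := rP u t ur tr.
  have Ntr : `|- t| < r by rewrite normrN.
  have [kNt _] := rP u (- t) ur Ntr.
  have Gt : G (ut t, t) = 0 by exact: eP.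
  have GNt : G (ut (- t), - t) = 0 by apply: eP; rewrite /= normrN.
  (* The identities for [k] identify a zero of [G] at parameter [t] with [ut t] and one at parameter
     [- t] with [ut (- t)]; the product vanishes when one of the factors does. *)
  rewrite cf; split=> -[-> H]; split=> //.
    move/eqP : H; rewrite mulf_eq0 => /orP[] /eqP H; [left|right].
      by rewrite -kt H.
    by rewrite -kNt H.
  by case: H => ->; rewrite ?Gt ?GNt ?mul0r ?mulr0.
(* The parameter [s = - t^2] is invariant under [t |-> - t], so one branch, with [t] of either sign,
   covers both points. *)
- suff H : \forall t \near (0 : R), t != 0 ->
      cuspidal_cross_cap (f (- t ^+ 2)) (ut t, 0).
    have [e [e0 eP]] := near_neq0_itv H.
    exists e; split=> // t te; split; first exact: eP.
    by rewrite -sqrrN; apply: eP; rewrite normrN.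
  have sNs : smooth_near (fun t : R => - t ^+ 2) 0.
    by apply: smooth_nearN; exact: smooth_nearX.
  have sNt : smooth_near (fun t : R => - t) 0 by exact: smooth_nearN.
  (* This and the following facts transport what holds near the origin to the points of the branch,
     by continuity of [ut] and [ut 0 = 0]. *)
  have N1 (g : R -> R) : smooth_near g 0 -> \forall t \near (0 : R), smooth_near g (ut t).
    move=> sg; apply: (smooth_near_preim (P := fun q => smooth_near g q) sut).
    by rewrite ut0; exact: smooth_near_near.
  have N2 (g : R * R -> R) : smooth_near g (0, 0) ->
      \forall t \near (0 : R), smooth_near g (ut t, - t ^+ 2).
    move=> sg; apply: (smooth_near_preim (P := fun q => smooth_near g q)
      (smooth_near_pair sut sNs)).
    by rewrite ut0 expr0n oppr0; exact: smooth_near_near.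
  have N3 (g : R * R * R -> R) : smooth_near g (0, 0, 0) ->
      \forall t \near (0 : R), smooth_near g (ut t, 0, - t ^+ 2).
    move=> sg; apply: (smooth_near_preim (P := fun q => smooth_near g q)
      (smooth_near_pair (smooth_near_pair sut (smooth_near_cst (0 : R) (0 : R))) sNs)).
    by rewrite ut0 expr0n oppr0; exact: smooth_near_near.
  have Nt (P : R * R -> Prop) : (\forall q \near (0 : R, 0 : R), P q) ->
      \forall t \near (0 : R), P (ut t, t).
    move=> HP; apply: (smooth_near_preim (smooth_near_pair sut sid)).
    by rewrite ut0.
  have NNt (P : R * R -> Prop) : (\forall q \near (0 : R, 0 : R), P q) ->
      \forall t \near (0 : R), P (ut t, - t).
    move=> HP; apply: (smooth_near_preim (smooth_near_pair sut sNt)).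
    by rewrite ut0 oppr0.
  have ND : \forall q \near (0 : R, 0 : R), 'D_(1, 0) G q != 0.
    have sD := smooth_near_derive ((1, 0) : R * R) sG.
    have c := smooth_near_continuous sD.
    by apply: (cvgr_neq0 _ c).
  near=> t => t0.
  have E0 : 0 < unit_part d1 (ut t, t).
    by near: t; apply: (Nt (fun q => 0 < unit_part d1 q)); exact: near_unit_part_gt0.
  have Gt : G (ut t, t) = 0 by near: t.
  have sGt : smooth_near G (ut t, t).
    by near: t; apply: (Nt (smooth_near G)); exact: smooth_near_near.
  have sGNt : smooth_near G (ut t, - t).
    by near: t; apply: (NNt (smooth_near G)); exact: smooth_near_near.
  have DG : 'D_(1, 0) G (ut t, t) != 0.
    by near: t; exact: (Nt (fun q => 'D_(1, 0) G q != 0)).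
  (* The factorization is to be differentiated in [u], so it has to hold on a neighbourhood of
     [(ut t, t)] and not just at that point. *)
  have fact : \forall q \near (ut t, t), c1 (q.1, - q.2 ^+ 2) = G q * G (q.1, - q.2).
    near: t; apply: (Nt (fun q => nbhs q [set x | c1 (x.1, - x.2 ^+ 2) =
      G x * G (x.1, - x.2)])); exact: nbhs_interior.
  (* At a zero of [G (., t)] the two terms of [half_root] coincide, so the other factor is twice [t]
     times the square root of [unit_part]. *)
  have GNt : G (ut t, - t) != 0.
    rewrite /G half_rootN; move: Gt; rewrite /G /half_root /= => /eqP.
    rewrite subr_eq0 => /eqP ->; rewrite -mulr2n mulrn_eq0 /= mulf_neq0//.
    by rewrite gt_eqF// sqrtr_gt0.
  have tf21 : smooth_near f21 (ut t) by near: t; exact: N1.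
  have tf31 : smooth_near f31 (ut t) by near: t; exact: N1.
  have tf24 : smooth_near f24 (ut t, - t ^+ 2) by near: t; exact: N2.
  have tf34 : smooth_near f34 (ut t, - t ^+ 2) by near: t; exact: N2.
  have tc0 : smooth_near c0 (ut t, - t ^+ 2) by near: t; exact: N2.
  have tc2 : smooth_near c2 (ut t, 0, - t ^+ 2) by near: t; exact: N3.
  have tc3 : smooth_near c3 (ut t, 0, - t ^+ 2) by near: t; exact: N3.
  set s := - t ^+ 2; set u0 := ut t.
  have su : smooth_near (fun u : R => u) u0 by exact: smooth_near_id.
  have scst (b : R) : smooth_near (fun u : R => b) u0 by exact: smooth_near_cst.
  have sG1 : smooth_near (fun u => G (u, t)) u0 by exact: smooth_near_comp2.
  have sG2 : smooth_near (fun u => G (u, - t)) u0 by exact: smooth_near_comp2.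
  (* Smoothness, vanishing and derivative of [c1 (., s)] at [u0] are all read off from this
     product. *)
  have fac1 : \forall u \near u0, G (u, t) * G (u, - t) = c1 (u, s).
    have := smooth_near_preim (P := fun q : R * R => c1 (q.1, - q.2 ^+ 2) =
      G q * G (q.1, - q.2)) (smooth_near_pair su (scst t)) fact.
    by apply: filterS => u ->.
  apply: (@cuspidal_cross_cap_normal _
    (fun u => u ^+ 2 * f21 u + u * s * f24 (u, s))
    (fun u => u ^+ 2 * f31 u + u * s * f34 (u, s))
    (fun u => c0 (u, s)) (fun u => c1 (u, s))
    (fun q => c2 (q.1, q.2, s)) (fun q => c3 (q.1, q.2, s))).
  + apply: smooth_nearD; apply: smooth_nearM => //; first exact: smooth_nearX.
      exact: smooth_nearM.
    exact: smooth_near_comp2.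
  + apply: smooth_nearD; apply: smooth_nearM => //; first exact: smooth_nearX.
      exact: smooth_nearM.
    exact: smooth_near_comp2.
  + exact: smooth_near_comp2.
  + by apply: eq_smooth_near fac1 _; exact: smooth_nearM.
  + by apply: smooth_near_comp3 => //;
      [exact: smooth_near_fst|exact: smooth_near_snd|exact: smooth_near_cst].
  + by apply: smooth_near_comp3 => //;
      [exact: smooth_near_fst|exact: smooth_near_snd|exact: smooth_near_cst].
  + by rewrite -(nbhs_singleton fac1) Gt mul0r.
  (* The factor [G (., t)] vanishes at [u0], so the product rule leaves [G (u0, - t)] times the
     derivative of [G (., t)], both nonzero. *)
  + rewrite -(near_eq_derive (1 : R) fac1).
    have := deriveM (smooth_near_derivable (v := 1 : R) sG1)
       (smooth_near_derivable (v := 1 : R) sG2).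
    rewrite Gt scale0r add0r => ->.
    rewrite -(@derive_fst_slice _ G (fun u => G (u, t)) u0 t)//.
      by rewrite scaler_eq0 negb_or GNt.
    exact: smooth_near_derivable.
  + move=> u v; rewrite /f /f_map /f32_of /=; congr (_, _, _); ring.
Unshelve. all: by end_near. Qed.
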